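(* Let $f:(M,Q)\to\mathbb{R}^n$ be isothermic and let $T\in\text{Möb}(n)$ be a conformal diffeomorphism of $S^n=\mathbb{R}^n\cup\{\infty\}$. Then, locally (where $T\circ f$ is $\mathbb{R}^n$-valued), $T\circ f$ is isothermic on $(M,Q)$.
   Context: $C\ell_n$ is the real Clifford algebra of Euclidean $\mathbb{R}^n$, with $vw+wv=-2(v,w)1$. For $C\ell_n$-valued 1-forms, $(\alpha\wedge\beta)(X,Y)=\alpha(X)\beta(Y)-\alpha(Y)\beta(X)$. A polarised Riemann surface $(M,Q)$ is a Riemann surface $M$ with a nonzero holomorphic quadratic differential $Q$. For $\mathbb{R}^n$-valued 1-forms, $(\alpha,\beta)^{2,0}=(\alpha(\partial_z),\beta(\partial_z))\,dz^2$ (complex bilinear extension). A conformal immersion $f:(M,Q)\to\mathbb{R}^n$ is isothermic if there is a map $f^c:M\to\mathbb{R}^n$ with $df\wedge df^c=0$ and $(df,df^c)^{2,0}=Q$. $\text{Möb}(n)$ is the Möbius group, generated by reflections in hyperplanes and inversions in hyperspheres of $\mathbb{R}^n$, extended to $\mathbb{R}^n\cup\{\infty\}$. *)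

(* Defs.v *)
From HB Require Import structures.
From mathcomp Require Import all_boot all_order all_algebra ring.
Set Implicit Arguments. Unset Strict Implicit. Unset Printing Implicit Defensive.
Import Order.TTheory GRing.Theory Num.Theory.
Local Open Scope ring_scope.

Definition symdiff (T : finType) (A B : {set T}) : {set T} :=
  (A :\: B) :|: (B :\: A).

Lemma in_symdiff (T : finType) (A B : {set T}) x :
  (x \in symdiff A B) = (x \in A) (+) (x \in B).
Proof. by rewrite !inE; case: (x \in A); case: (x \in B). Qed.

Lemma symdiffK (T : finType) (A : {set T}) : involutive (symdiff A).
Proof. by move=> B; apply/setP=> x; rewrite !in_symdiff addKb. Qed.

Lemma symdiffA (T : finType) : associative (@symdiff T).
Proof. by move=> A B C; apply/setP=> x; rewrite !in_symdiff addbA. Qed.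

Lemma symdiffC (T : finType) : commutative (@symdiff T).
Proof. by move=> A B; apply/setP=> x; rewrite !in_symdiff addbC. Qed.

Lemma symdiff0 (T : finType) (A : {set T}) : symdiff A set0 = A.
Proof. by apply/setP=> x; rewrite in_symdiff inE addbF. Qed.

Lemma symdiff_id (T : finType) (A : {set T}) : symdiff A A = set0.
Proof. by apply/setP=> x; rewrite in_symdiff inE addbb. Qed.

Lemma prod_symdiff (R : comNzRingType) (T : finType) (A B : {set T})
    (g : T -> bool) :
  \prod_(i in symdiff A B) (-1) ^+ g i =
  (\prod_(i in A) (-1) ^+ g i) * (\prod_(i in B) (-1) ^+ g i) :> R.
Proof.
rewrite !(big_mkcond (fun i => i \in _)) -big_split /=.
apply: eq_bigr => i _; rewrite in_symdiff.
case: (i \in A); case: (i \in B); rewrite /= ?mulr1 ?mul1r //.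
by rewrite -expr2 sqrr_sign.
Qed.

(* Moving the factors of e_T past those of e_S costs a sign for each pair
   j < i and replaces e_i e_i by -1 for each i = j, so that
   e_S e_T = clifford_sign S T e_(symdiff S T), where e_S denotes the product
   of the generators e_i, i in S, in increasing order. *)
Definition clifford_sign (R : comNzRingType) n (S T : {set 'I_n}) : R :=
  \prod_(i in S) \prod_(j in T) (-1) ^+ (j <= i)%N.

Lemma clifford_signDr (R : comNzRingType) n (S T U : {set 'I_n}) :
  clifford_sign R S (symdiff T U) = clifford_sign R S T * clifford_sign R S U.
Proof.
rewrite /clifford_sign -big_split /=.
by apply: eq_bigr => i _; rewrite prod_symdiff.
Qed.

Lemma clifford_signDl (R : comNzRingType) n (S T U : {set 'I_n}) :
  clifford_sign R (symdiff S T) U = clifford_sign R S U * clifford_sign R T U.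
Proof.
have swap (V : {set 'I_n}) : clifford_sign R V U =
    \prod_(j in U) \prod_(i in V) (-1) ^+ (j <= i)%N.
  by rewrite /clifford_sign exchange_big.
rewrite !swap -big_split /=.
by apply: eq_bigr => j _; rewrite prod_symdiff.
Qed.

Lemma clifford_sign0l (R : comNzRingType) n (S : {set 'I_n}) :
  clifford_sign R set0 S = 1.
Proof. by rewrite /clifford_sign big_set0. Qed.

Lemma clifford_sign0r (R : comNzRingType) n (S : {set 'I_n}) :
  clifford_sign R S set0 = 1.
Proof. by rewrite /clifford_sign big1 // => i _; rewrite big_set0. Qed.

(* The Clifford algebra with v w + w v = - 2 (v, w) 1 (see clifford_vecM), by
   its coordinates in the basis e_S; clifford_basis_cons expresses e_S as a
   product of generators. *)
Definition clifford (R : comNzRingType) (n : nat) : Type :=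
  {ffun {set 'I_n} -> R}.

HB.instance Definition _ (R : comNzRingType) n :=
  GRing.Lmodule.copy (clifford R n) {ffun {set 'I_n} -> R^o}.

Definition clifford_basis (R : comNzRingType) n (S : {set 'I_n}) :
  clifford R n := [ffun T => (T == S)%:R].

Definition clifford_mul (R : comNzRingType) n (a b : clifford R n) :
    clifford R n :=
  [ffun U => \sum_(S : {set 'I_n})
     clifford_sign R S (symdiff S U) * (a S * b (symdiff S U))].

Section CliffordRing.
Context (R : comNzRingType) (n : nat).
Implicit Types a b c : clifford R n.

Lemma clifford_mulA : associative (@clifford_mul R n).
Proof.
move=> a b c; apply/ffunP=> U; rewrite !ffunE.
transitivity (\sum_S \sum_V clifford_sign R S (symdiff S V) *
   clifford_sign R V (symdiff V U) * (a S * b (symdiff S V) * c (symdiff V U))).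
  apply: eq_bigr => S _; rewrite ffunE mulr_sumr mulr_sumr.
  rewrite (reindex_inj (inv_inj (symdiffK S))) /=.
  apply: eq_bigr => V _.
  have -> : symdiff (symdiff S V) (symdiff S U) = symdiff V U.
    by rewrite (symdiffC S V) -symdiffA symdiffK.
  have -> : symdiff S U = symdiff (symdiff S V) (symdiff V U).
    by rewrite -symdiffA symdiffK.
  rewrite {1}(clifford_signDr R S) clifford_signDl.
  have s2 : clifford_sign R S (symdiff V U) * clifford_sign R S (symdiff V U) = 1.
    by rewrite -clifford_signDr symdiff_id clifford_sign0r.
  by rewrite -[RHS]mul1r -s2; ring.
rewrite exchange_big; apply: eq_bigr => V _ /=.
rewrite ffunE !mulr_suml mulr_sumr; apply: eq_bigr => S _.
by ring.
Qed.

Lemma clifford_mul1l : left_id (@clifford_basis R n set0) (@clifford_mul R n).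
Proof.
move=> a; apply/ffunP=> U; rewrite ffunE (bigD1 set0) //= big1 => [|S S0].
  by rewrite clifford_sign0l ffunE eqxx !mul1r addr0 symdiffC symdiff0.
by rewrite ffunE (negPf S0) mul0r mulr0.
Qed.

Lemma clifford_mul1r : right_id (@clifford_basis R n set0) (@clifford_mul R n).
Proof.
move=> a; apply/ffunP=> U; rewrite ffunE (bigD1 U) //= big1 => [|S SU].
  by rewrite symdiff_id clifford_sign0r ffunE eqxx mul1r mulr1 addr0.
rewrite !ffunE (_ : (_ == _) = false) ?mulr0 //; apply/negbTE.
apply: contra SU => /eqP h.
by rewrite -[S]symdiff0 -h symdiffK.
Qed.

Lemma clifford_mulDl :
  left_distributive (@clifford_mul R n) (@GRing.add (clifford R n)).
Proof.
move=> a b c; apply/ffunP=> U; rewrite !ffunE -big_split /=.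
by apply: eq_bigr => S _; rewrite !ffunE mulrDl mulrDr.
Qed.

Lemma clifford_mulDr :
  right_distributive (@clifford_mul R n) (@GRing.add (clifford R n)).
Proof.
move=> a b c; apply/ffunP=> U; rewrite !ffunE -big_split /=.
by apply: eq_bigr => S _; rewrite !ffunE mulrDr mulrDr.
Qed.

Lemma clifford_1neq0 : @clifford_basis R n set0 != 0.
Proof.
by apply/eqP => /ffunP /(_ set0) /eqP; rewrite !ffunE eqxx oner_eq0.
Qed.

HB.instance Definition _ := GRing.Zmodule_isNzRing.Build (clifford R n)
  clifford_mulA clifford_mul1l clifford_mul1r clifford_mulDl clifford_mulDr
  clifford_1neq0.

Lemma clifford_scaleAl (k : R) a b : k *: (a * b) = (k *: a) * b.
Proof.
apply/ffunP=> U; rewrite !ffunE scaler_sumr; apply: eq_bigr => S _.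
by rewrite ffunE /GRing.scale /= mulrCA !mulrA.
Qed.

HB.instance Definition _ :=
  GRing.Lmodule_isLalgebra.Build R (clifford R n) clifford_scaleAl.

Lemma clifford_scaleAr (k : R) a b : k *: (a * b) = a * (k *: b).
Proof.
apply/ffunP=> U; rewrite !ffunE scaler_sumr; apply: eq_bigr => S _.
rewrite ffunE /GRing.scale /= mulrCA; congr (_ * _).
by rewrite mulrCA.
Qed.

HB.instance Definition _ :=
  GRing.Lalgebra_isAlgebra.Build R (clifford R n) clifford_scaleAr.

End CliffordRing.

Definition dot (R : pzSemiRingType) n (v w : 'rV[R]_n) : R :=
  \sum_(i < n) v 0 i * w 0 i.

(* The inclusion of R^n in its Clifford algebra. *)
Definition clifford_vec (R : comNzRingType) n (v : 'rV[R]_n) : clifford R n :=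
  \sum_(i < n) v 0 i *: clifford_basis R [set i].

Lemma clifford_basisM (R : comNzRingType) n (S T : {set 'I_n}) :
  clifford_basis R S * clifford_basis R T =
  clifford_sign R S T *: clifford_basis R (symdiff S T).
Proof.
apply/ffunP=> U; rewrite !ffunE (bigD1 S) //= big1 => [|V VS]; last first.
  by rewrite ffunE (negPf VS) mul0r mulr0.
rewrite !ffunE eqxx mul1r addr0 /GRing.scale /=.
rewrite (_ : (symdiff S U == T) = (U == symdiff S T)).
  by case: eqP => [->|_]; rewrite ?symdiffK // !mulr0.
by apply/eqP/eqP => [<-|->]; rewrite symdiffK.
Qed.

Lemma clifford_basis_cons (R : comNzRingType) n (i : 'I_n) (S : {set 'I_n}) :
  {in S, forall j : 'I_n, (i < j)%N} ->
  clifford_basis R (i |: S) = clifford_basis R [set i] * clifford_basis R S.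
Proof.
move=> iS; rewrite clifford_basisM /clifford_sign big_set1 big1 => [|j /iS ij].
  rewrite scale1r; congr clifford_basis; apply/setP=> j.
  rewrite in_symdiff !inE; case: eqP => [->|//] /=.
  by apply/esym/negP => /iS; rewrite ltnn.
by rewrite leqNgt ij.
Qed.

Lemma clifford_vecM (R : comNzRingType) n (v w : 'rV[R]_n) :
  clifford_vec v * clifford_vec w + clifford_vec w * clifford_vec v =
  - (2 * dot v w) *: 1.
Proof.
have gen (i j : 'I_n) : clifford_basis R [set i] * clifford_basis R [set j] +
    clifford_basis R [set j] * clifford_basis R [set i] =
    - (2 * (i == j)%:R) *: 1.
  rewrite !clifford_basisM (symdiffC [set j]) -scalerDl /clifford_sign !big_set1.
  have [->|ij] := eqVneq i j.
    by rewrite leqnn symdiff_id expr1 -opprD mulr1.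
  rewrite mulr0 oppr0 scale0r.
  have /orP[ltij|ltij] : (i < j)%N || (j < i)%N by rewrite -neq_ltn.
    by rewrite (ltnW ltij) leqNgt ltij addrN scale0r.
  by rewrite (ltnW ltij) leqNgt ltij addNr scale0r.
rewrite /clifford_vec !mulr_suml.
under eq_bigr do rewrite mulr_sumr.
rewrite [X in _ + X](eq_bigr _ (fun i _ => mulr_sumr _ _ _ _)).
rewrite [X in _ + X]exchange_big -big_split /=.
transitivity (\sum_(i < n) \sum_(j < n)
   (- (2 * (v 0 i * w 0 j * (i == j)%:R)) *: (1 : clifford R n))).
  apply: eq_bigr => i _; rewrite -big_split; apply: eq_bigr => j _ /=.
  rewrite -!scalerAl -!scalerAr !scalerA [w 0 j * _]mulrC -scalerDr gen scalerA.
  by rewrite mulrN mulrCA.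
rewrite /dot mulr_sumr -sumrN scaler_suml; apply: eq_bigr => i _.
rewrite (bigD1 i) //= big1 ?addr0 ?eqxx ?mulr1 // => j ji.
by rewrite eq_sym (negPf ji) !mulr0 oppr0 scale0r.
Qed.

From mathcomp Require Import all_classical all_reals all_analysis complex.
Import numFieldNormedType.Exports.
Local Open Scope classical_set_scope.

(* Only the values of chart i on dom i and of param i on chart i @` dom i are
   meaningful. *)
Record riemannSurface (R : realType) := RiemannSurface {
  surface :> topologicalType;
  atlas : Type;
  dom : atlas -> set surface;
  chart : atlas -> surface -> R[i]^o;
  param : atlas -> R[i]^o -> surface;
  surface_hausdorff : hausdorff_space surface;
  surface_connected : connected [set: surface];
  dom_open : forall i, open (dom i);
  dom_cover : forall p, exists i, dom i p;
  codom_open : forall i, open (chart i @` dom i);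
  chartK : forall i p, dom i p -> param i (chart i p) = p;
  chart_continuous : forall i p, dom i p -> {for p, continuous (chart i)};
  param_continuous : forall i p, dom i p ->
    {for chart i p, continuous (param i)};
  transition_holomorphic : forall i j p, dom i p -> dom j p ->
    derivable (chart j \o param i) (chart i p) 1 }.

Arguments dom {R} r _ _.
Arguments chart {R} r _ _.
Arguments param {R} r _ _.

(* The differential is qcoef i (z) dz^2 in the coordinate z = chart i. *)
Record quadraticDifferential (R : realType) (M : riemannSurface R) :=
  QuadraticDifferential {
  qcoef : atlas M -> R[i]^o -> R[i]^o;
  qcoef_holomorphic : forall i p, dom M i p ->
    derivable (qcoef i) (chart M i p) 1;
  qcoef_transition : forall i j p, dom M i p -> dom M j p ->
    qcoef i (chart M i p) = qcoef j (chart M j p) *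
      ('D_1 (chart M j \o param M i) (chart M i p)) ^+ 2 }.

Record polarisedSurface (R : realType) := PolarisedSurface {
  underlying :> riemannSurface R;
  polarisation : quadraticDifferential underlying;
  polarisation_neq0 : exists i p, dom underlying i p /\
    qcoef polarisation i (chart underlying i p) != 0 }.

Definition toC (R : realType) (x : R * R) : R[i]^o := (x.1 +i* x.2)%C.
Definition ofC (R : realType) (z : R[i]) : R * R := (complex.Re z, complex.Im z).

Definition local_expr (R : realType) (M : riemannSurface R) n
    (f : M -> 'rV[R]_n) (i : atlas M) : R * R -> 'rV[R]_n :=
  fun x => f (param M i (toC x)).

(* Class C^k on the open set D of the plane. *)
Fixpoint class_C (R : realType) n (k : nat) (D : set (R * R))
    (F : R * R -> 'rV[R]_n) : Prop :=
  if k is k'.+1 then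
    [/\ forall x, D x -> differentiable F x,
        class_C k' D ('D_(1, 0) F) & class_C k' D ('D_(0, 1) F)]
  else forall x, D x -> {for x, continuous F}.

(* Smoothness of f on the open set U. *)
Definition smooth_on (R : realType) (M : riemannSurface R) n (U : set M)
    (f : M -> 'rV[R]_n) : Prop :=
  forall i k, class_C k [set x | (chart M i @` (dom M i `&` U)) (toC x)]
                      (local_expr f i).

(* df at p, for p in dom i, tangent vectors at p being identified with elements
   of R * R by the coordinate chart i. *)
Definition differential (R : realType) (M : riemannSurface R) n
    (f : M -> 'rV[R]_n) (i : atlas M) (p : M) : R * R -> 'rV[R]_n :=
  'd (local_expr f i) (ofC (chart M i p)).

(* df is injective and the induced metric is conformal, that is, a positive
   multiple of |dz|^2. *)
Definition conformal_immersion_on (R : realType) (M : riemannSurface R) n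
    (U : set M) (f : M -> 'rV[R]_n) : Prop :=
  forall i p, dom M i p -> U p ->
    injective (differential f i p) /\
    exists2 l : R, 0 < l & forall X Y : R * R,
      dot (differential f i p X) (differential f i p Y) =
      l * (X.1 * Y.1 + X.2 * Y.2).

(* The product of R^n-valued 1-forms at a point is taken in the Clifford
   algebra. *)
Definition wedge (R : realType) n (a b : R * R -> 'rV[R]_n) (X Y : R * R) :
    clifford R n :=
  clifford_vec (a X) * clifford_vec (b Y) -
  clifford_vec (a Y) * clifford_vec (b X).

(* The value of the complex linear extension of a at
   d/dz = (d/dx - i d/dy) / 2. *)
Definition at_dz (R : realType) n (a : R * R -> 'rV[R]_n) : 'rV[R[i]]_n :=
  2^-1 *: (map_mx (real_complex R) (a (1, 0)) -
           'i%C *: map_mx (real_complex R) (a (0, 1))).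

(* The coefficient of dz^2 in (a, b)^{2,0}. *)
Definition part20 (R : realType) n (a b : R * R -> 'rV[R]_n) : R[i] :=
  dot (at_dz a) (at_dz b).

(* f is isothermic on the open subset U of M, polarised by the restriction of
   the polarisation of M. *)
Definition isothermic_on (R : realType) n (M : polarisedSurface R)
    (U : set M) (f : M -> 'rV[R]_n) : Prop :=
  [/\ smooth_on U f,
      conformal_immersion_on U f
    & exists fc : M -> 'rV[R]_n, smooth_on U fc /\
      forall i p, dom M i p -> U p ->
        (forall X Y, wedge (differential f i p) (differential fc i p) X Y = 0)
        /\ part20 (differential f i p) (differential fc i p) =
           qcoef (polarisation M) i (chart M i p)].

Definition isothermic (R : realType) n (M : polarisedSurface R)
    (f : M -> 'rV[R]_n) : Prop := isothermic_on [set: M] f.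

(* R^n with a point at infinity, None. *)
Definition sphere (R : realType) (n : nat) : Type :=
  one_point_compactification 'rV[R]_n.

(* Reflection in the hyperplane (x, a) = c, for a != 0. *)
Definition hyperplane_reflection (R : realType) n (a : 'rV[R]_n) (c : R)
    (x : sphere R n) : sphere R n :=
  if x is Some v then Some (v - (2 * (dot v a - c) / dot a a) *: a) else None.

(* Inversion in the hypersphere with centre c and radius r > 0. *)
Definition sphere_inversion (R : realType) n (c : 'rV[R]_n) (r : R)
    (x : sphere R n) : sphere R n :=
  if x is Some v then
    if v == c then None
    else Some (c + (r ^+ 2 / dot (v - c) (v - c)) *: (v - c))
  else Some c.

(* The generators are involutions, so their compositions form a group. *)
Inductive moebius (R : realType) n : (sphere R n -> sphere R n) -> Prop :=
| moebius_id : moebius id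
| moebius_reflection a c T : a != 0 -> moebius T ->
    moebius (hyperplane_reflection a c \o T)
| moebius_inversion c r T : 0 < r -> moebius T ->
    moebius (sphere_inversion c r \o T).

(* Main.v *)
(* On the light cone of R^(n+1,1), with v represented by (v, |v|^2, 1), the
   generators of the Moebius group act as Lorentz reflections; hence T is
   v |-> N v / m v, where N and m are components of one linear isometry L
   applied to (v, |v|^2, 1), which also handles intermediate images at infinity.
   As T is conformal with factor 1 / |m|, the dual surface of g = T o f must
   satisfy dg^c = m^2 dT (df^c) = m dN (df^c) - dm (df^c) N. This form is closed
   because df /\ df^c = 0, so g^c exists on a coordinate rectangle. In any other
   chart g^c is differentiable by the chain rule and its partial derivatives are
   given by the same smooth expression, so g^c is smooth although transition
   maps are only known to be complex differentiable. *)

From HB Require Import structures.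
Require Import Defs.
From mathcomp Require Import all_boot all_order all_algebra ring lra.
From mathcomp Require Import all_classical all_reals all_analysis complex.
Import Order.TTheory GRing.Theory Num.Theory.
Import numFieldNormedType.Exports.

Set Implicit Arguments. Unset Strict Implicit. Unset Printing Implicit Defensive.

Local Open Scope classical_set_scope.
Local Open Scope ring_scope.

(** * The light cone model *)

(** The hypothesis on df and df^c is turned into plain linear algebra. Let X, Y be the partial
    derivatives of f, orthogonal and of equal length. The Clifford equation forces the partial
    derivatives of f^c to be aX + bY and bX - aY; positive definiteness of the inner product is what
    excludes a component normal to the surface. Closedness of m dN (df^c) - dm (df^c) N then reduces
    to three comparisons between the two orders of differentiation: the mixed partials of f^c agree,
    the inner products (Y, f^c_x) and (X, f^c_y) both equal b |X|^2, and the minors formed from the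
    linear components m and N both equal a times the minor of X and Y. Write P for the map X |-> m
    dN X - dm X N. By the quotient rule dT = m^-2 P, and P multiplies inner products by m^2. Hence
    dg = m^-2 P df and dg^c = P df^c, so (dg, dg^c) = (df, df^c) and Q is reproduced exactly, while
    the pair (a, b) becomes (m^2 a, m^2 b), which gives back the Clifford equation. *)

Section Dot.
Context (R : comNzRingType) (n : nat).
Implicit Types (u v w : 'rV[R]_n) (k : R).

Lemma dotC u v : dot u v = dot v u.
Proof. by apply: eq_bigr => i _; rewrite mulrC. Qed.

Lemma dotDl u v w : dot (u + v) w = dot u w + dot v w.
Proof.
by rewrite /dot -big_split; apply: eq_bigr => i _; rewrite mxE mulrDl.
Qed.

Lemma dotZl k u v : dot (k *: u) v = k * dot u v.
Proof.
by rewrite /dot mulr_sumr; apply: eq_bigr => i _; rewrite mxE mulrA.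
Qed.

Lemma dotDr u v w : dot u (v + w) = dot u v + dot u w.
Proof. by rewrite dotC dotDl !(dotC u). Qed.

Lemma dotZr k u v : dot u (k *: v) = k * dot u v.
Proof. by rewrite dotC dotZl (dotC u). Qed.

Lemma dotNl u v : dot (- u) v = - dot u v.
Proof. by rewrite -scaleN1r dotZl mulN1r. Qed.

Lemma dotNr u v : dot u (- v) = - dot u v.
Proof. by rewrite dotC dotNl (dotC u). Qed.

Lemma dot0l v : dot 0 v = 0.
Proof. by rewrite -(scale0r 0) dotZl mul0r. Qed.

Lemma dot0r v : dot v 0 = 0.
Proof. by rewrite dotC dot0l. Qed.

Definition dotE := (dotDl, dotDr, dotZl, dotZr, dotNl, dotNr, dot0l, dot0r).

End Dot.

Lemma dot_ge0 (R : realDomainType) n (v : 'rV[R]_n) : 0 <= dot v v.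
Proof. by apply: sumr_ge0 => i _; rewrite -expr2 sqr_ge0. Qed.

Lemma dot_eq0 (R : realDomainType) n (v : 'rV[R]_n) :
  (dot v v == 0) = (v == 0).
Proof.
apply/eqP/eqP => [|->]; last by rewrite dot0l.
move/eqP; rewrite psumr_eq0 => [/allP h|i _]; last by rewrite -expr2 sqr_ge0.
apply/rowP => i; rewrite mxE; apply/eqP.
by have := h i (mem_index_enum i); rewrite -expr2 sqrf_eq0.
Qed.

Section LightCone.
Context (R : realFieldType) (n : nat).
Implicit Types (v w X Y : 'rV[R]_n).

Definition lorentz : Type := ('rV[R]_n * R^o * R^o)%type.
HB.instance Definition _ := GRing.Lmodule.on lorentz.
Implicit Types (u s : lorentz).

(** The polarisation of |x|^2 - p m, of signature (n+1, 1); the last two components are null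
    coordinates. *)
Definition lform u s : R :=
  dot u.1.1 s.1.1 - (u.1.2 * s.2 + s.1.2 * u.2) / 2.

Definition cone v : lorentz := (v, dot v v, 1).

(** The derivative of [cone] at v in the direction X. *)
Definition dcone v X : lorentz := (X, 2 * dot v X, 0).

(* A null vector (x, p, m), that is |x|^2 = p m, is sent to the point x / m of
   the sphere; cone is a section. *)
Definition cone_point u : option 'rV[R]_n :=
  if u.2 == 0 then None else Some (u.2^-1 *: u.1.1).

Lemma lformC u s : lform u s = lform s u.
Proof. by rewrite /lform dotC addrC [in RHS]addrC (addrC (u.1.2 * _)). Qed.

Lemma lformDl u u' s : lform (u + u') s = lform u s + lform u' s.
Proof. by rewrite /lform /= dotDl; field. Qed.

Lemma lformZl (k : R) u s : lform (k *: u) s = k * lform u s.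
Proof. by rewrite /lform /= dotZl /GRing.scale /=; field. Qed.

Definition lreflection s u : lorentz := u - (2 * lform u s / lform s s) *: s.

Lemma lreflection_linear s : linear (lreflection s).
Proof.
move=> k u u'; rewrite /lreflection lformDl lformZl scalerBr addrACA -opprD.
by congr (_ - _); rewrite scalerA -scalerDl; congr (_ *: _); ring.
Qed.

Lemma lreflection_lform s u u' : lform s s != 0 ->
  lform (lreflection s u) (lreflection s u') = lform u u'.
Proof.
move=> s0; rewrite /lreflection.
set k := _ / _; set k' := (2 * lform u' s / _); rewrite -![- (_ *: s)]scaleNr.
rewrite lformDl lformZl !(lformC _ (u' + _)) !lformDl !lformZl (lformC u' u)
  (lformC s u).
by rewrite /k /k'; field.
Qed.

Lemma lform_cone v : lform (cone v) (cone v) = 0.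
Proof. by rewrite /lform /=; field. Qed.

Lemma lform_cone_dcone v X : lform (cone v) (dcone v X) = 0.
Proof. by rewrite /lform /=; field. Qed.

Lemma lform_dcone v X Y : lform (dcone v X) (dcone v Y) = dot X Y.
Proof. by rewrite /lform /=; field. Qed.

(** If [L u = 0], then u is orthogonal to every vector, and the form is nondegenerate: testing
    against (0, 0, 1), (0, 1, 0) and (x, 0, 0) kills the three components in turn. *)
Lemma lform_inj (L : lorentz -> lorentz) : linear L ->
  (forall u s, lform (L u) (L s) = lform u s) -> forall u, L u = 0 -> u = 0.
Proof.
move=> Llin Liso [[x p] m] Lu0.
have h (y : 'rV[R]_n) (q l : R) : dot x y - (p * l + q * m) / 2 = 0.
  rewrite -[LHS]/(lform (x, p, m) (y, q, l)) -Liso Lu0 /lform /= dot0l.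
  by rewrite mul0r mulr0 addr0 mul0r subr0.
have p0 : p = 0 by have := h 0 0 1; rewrite dot0r; lra.
have m0 : m = 0 by have := h 0 1 0; rewrite dot0r; lra.
have /eqP := h x 0 0; rewrite p0 m0 !mul0r addr0 mul0r subr0 dot_eq0 => /eqP ->.
by [].
Qed.

Lemma cone_neq0 v : cone v <> 0.
Proof. by case=> _ _ /eqP; rewrite oner_eq0. Qed.

Section Isometry.
Variable L : lorentz -> lorentz.
Hypothesis L_lin : linear L.
Hypothesis L_iso : forall u s, lform (L u) (L s) = lform u s.

Definition cden v : R := (L (cone v)).2.
Definition cnum v : 'rV[R]_n := (L (cone v)).1.1.

(* cden v ^- 2 *: cpsi v is the derivative at v of cnum / cden. *)
Definition cpsi v X : 'rV[R]_n :=
  cden v *: (L (dcone v X)).1.1 - (L (dcone v X)).2 *: cnum v.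

(** Conformality of T with the denominators cleared, so it also holds where [cden v] vanishes.
    Isometry expresses every inner product of first components through the other two components, and
    these cancel. *)
Lemma cpsi_dot v X Y : dot (cpsi v X) (cpsi v Y) = cden v ^+ 2 * dot X Y.
Proof.
have := L_iso (cone v) (cone v); rewrite lform_cone {1}/lform.
have := L_iso (cone v) (dcone v X); rewrite lform_cone_dcone {1}/lform.
have := L_iso (cone v) (dcone v Y); rewrite lform_cone_dcone {1}/lform.
have := L_iso (dcone v X) (dcone v Y); rewrite lform_dcone {1}/lform.
rewrite /cpsi /cden /cnum.
case: (L (cone v)) => -[x p] m; case: (L (dcone v X)) => -[y q] l.
case: (L (dcone v Y)) => -[z r] k /=.
rewrite !dotE (dotC y x).
move=> /(canRL (subrK _)) yz /(canRL (subrK _)) -> /(canRL (subrK _)) ->.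
move=> /(canRL (subrK _)) ->; rewrite yz.
by field.
Qed.

Lemma dcone_linear v : linear (dcone v).
Proof.
move=> k X Y; apply/pair_equal_spec; split; last by rewrite /= scaler0 addr0.
by apply/pair_equal_spec; split; rewrite //= !dotE /GRing.scale /=; ring.
Qed.

Lemma cpsi_linear v : linear (cpsi v).
Proof.
move=> k X Y; rewrite /cpsi dcone_linear L_lin /=.
set a := L _; set b := L _.
rewrite scalerDr scalerDl scalerBr !scalerA (mulrC k (cden v)).
by rewrite opprD addrACA.
Qed.

End Isometry.
End LightCone.

(** The vector s = (a, 2c, 0) represents the hyperplane: [lform (cone v) s] is (v, a) - c. Its last
    component is 0, so the reflection fixes infinity. *)
Lemma cone_point_hyperplane (R : realType) n (a : 'rV[R]_n) (c : R) :
  a != 0 -> forall u, lform u u = 0 ->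
  hyperplane_reflection a c (cone_point u) =
  cone_point (lreflection (a, 2 * c, 0) u).
Proof.
rewrite -dot_eq0 => a0 [[x p] m] _.
rewrite /cone_point /lreflection /lform /= scaler0 subr0.
have [//|m0] := eqVneq m 0.
congr Some; rewrite dotE scalerBr !scalerA; congr (_ - _ *: _).
by field; rewrite a0 m0.
Qed.

(** The vector s = (c, |c|^2 - r^2, 1) represents the sphere: [lform (cone v) s] is (r^2 - |v -
    c|^2) / 2, and [lform s s] is r^2. *)
Lemma cone_point_inversion (R : realType) n (c : 'rV[R]_n) (r : R) :
  0 < r -> forall u, lform u u = 0 -> u != 0 ->
  sphere_inversion c r (cone_point u) =
  cone_point (lreflection (c, dot c c - r ^+ 2, 1) u).
Proof.
move=> r0 [[x p] m]; rewrite {1}/lform /= => /eqP.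
rewrite subr_eq0 => /eqP xx u0.
have {}xx : dot x x = p * m by rewrite xx; field.
have rr : r != 0 by rewrite gt_eqF.
pose d := dot x c - (p * 1 + (dot c c - r ^+ 2) * m) / 2.
have lE : lform (c, dot c c - r ^+ 2, 1) (c, dot c c - r ^+ 2, 1) = r ^+ 2.
  by rewrite /lform /=; field.
rewrite /cone_point /lreflection lE.
have -> : lform (x, p, m) (c, dot c c - r ^+ 2, 1) = d by [].
rewrite /= [_ *: (1 : R^o)]mulr1.
have [m0|m0] := eqVneq m 0.
  (* Over infinity a nonzero null vector is (0, p, 0) with p nonzero; its reflection is p / r^2
     times [cone c]. *)
  have x0 : x = 0 by apply/eqP; rewrite -dot_eq0 xx m0 mulr0.
  have p0 : p != 0 by apply: contra u0 => /eqP ->; rewrite x0 m0.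
  have dE : d = - p / 2 by rewrite /d x0 m0 dot0l; field.
  have -> : (m - 2 * d / r ^+ 2) = p / r ^+ 2 by rewrite m0 dE; field.
  rewrite ifF; last first.
    by apply/negbTE; rewrite mulf_neq0 // invr_neq0 // expf_neq0.
  rewrite x0 sub0r -scaleNr scalerA /=; congr Some.
  rewrite -[LHS]scale1r; congr (_ *: _); rewrite dE; field.
  by rewrite rr p0.
(* Hence the last component of the reflected vector is m |x/m - c|^2 / r^2, which vanishes exactly
   when the point is the centre. *)
have D : dot (m^-1 *: x - c) (m^-1 *: x - c) = (r ^+ 2 * m - 2 * d) / m.
  by rewrite !dotE xx (dotC c x) /d; field.
have mE : (m - 2 * d / r ^+ 2 == 0) = (m^-1 *: x == c).
  rewrite -[RHS]subr_eq0 -dot_eq0 D mulf_eq0 invr_eq0 (negPf m0) orbF.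
  have -> : m - 2 * d / r ^+ 2 = (r ^+ 2 * m - 2 * d) / r ^+ 2 by field.
  by rewrite mulf_eq0 invr_eq0 expf_eq0 (negPf rr) orbF.
rewrite [sphere_inversion _ _ _]/= mE; case: ifPn => // nc; congr Some.
have D0 : r ^+ 2 * m - 2 * d != 0.
  apply: contra nc => /eqP D0.
  by rewrite -subr_eq0 -dot_eq0 D D0 mul0r.
clearbody d; rewrite D !scalerBr !scalerA.
set k1 := _ / _ * m^-1; set k2 := _ / _; set k3 := (_ - _)^-1.
rewrite addrCA -[X in _ = _ - X *: c]opprK scaleNr opprK.
congr (_ *: x + _).
  by rewrite /k1 /k3; field; rewrite rr m0 (mulrC m) D0.
rewrite -{1}[c]scale1r -scalerBl; congr (_ *: c).
by rewrite /k2 /k3; field; rewrite rr m0 (mulrC m) D0.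
Qed.

(** The induction needs [L (cone v)] to be null and nonzero; the first holds since L is an isometry,
    the second by [lform_inj]. *)
Lemma moebius_isometry (R : realType) n (T : sphere R n -> sphere R n) :
  moebius T -> exists L : lorentz R n -> lorentz R n,
    [/\ linear L, forall u s, lform (L u) (L s) = lform u s
      & forall v, T (Some v) = cone_point (L (cone v))].
Proof.
elim=> [|a c {}T a0 _ [L [Ll Li LT]]|c r {}T r0 _ [L [Ll Li LT]]].
- by exists id; split=> // v; rewrite /cone_point /= oner_eq0 invr1 scale1r.
- set s : lorentz R n := (a, 2 * c, 0).
  have s0 : lform s s != 0.
    by rewrite /lform /= !(mulr0, mul0r) addr0 mul0r subr0 dot_eq0.
  exists (lreflection s \o L); split=> [k u v|u v|v] /=.
  + by rewrite Ll lreflection_linear.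
  + by rewrite lreflection_lform.
  + by rewrite LT cone_point_hyperplane // Li lform_cone.
- set s : lorentz R n := (c, dot c c - r ^+ 2, 1).
  have s0 : lform s s != 0.
    have -> : lform s s = r ^+ 2 by rewrite /lform /=; field.
    by rewrite expf_neq0 // gt_eqF.
  exists (lreflection s \o L); split=> [k u v|u v|v] /=.
  + by rewrite Ll lreflection_linear.
  + by rewrite lreflection_lform.
  + rewrite LT cone_point_inversion ?Li ?lform_cone //.
    by apply/eqP => /(lform_inj Ll Li) /cone_neq0.
Qed.

(** * Isothermic conditions at a point *)

Section CliffordVectors.
Context (R : realType) (n : nat).
Implicit Types (v w x y : 'rV[R]_n) (k : R).

Lemma clifford_vecD v w :
  clifford_vec (v + w) = clifford_vec v + clifford_vec w.
Proof.
rewrite /clifford_vec -big_split; apply: eq_bigr => i _.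
by rewrite mxE scalerDl.
Qed.

Lemma clifford_vecZ k v : clifford_vec (k *: v) = k *: clifford_vec v.
Proof.
rewrite /clifford_vec scaler_sumr; apply: eq_bigr => i _.
by rewrite mxE scalerA.
Qed.

Lemma clifford_vecN v : clifford_vec (- v) = - clifford_vec v.
Proof. by rewrite -scaleN1r clifford_vecZ scaleN1r. Qed.

Definition clifford_vecE := (clifford_vecD, clifford_vecN, clifford_vecZ).

Lemma clifford_vec_sqr v : clifford_vec v * clifford_vec v = - dot v v *: 1.
Proof.
apply: (@scalerI _ _ 2); first by rewrite pnatr_eq0.
by rewrite scaler_nat mulr2n clifford_vecM scalerA mulrN.
Qed.

Lemma clifford_vec_anticomm v w : dot v w = 0 ->
  clifford_vec v * clifford_vec w = - (clifford_vec w * clifford_vec v).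
Proof.
by move=> vw; apply/eqP; rewrite -addr_eq0 clifford_vecM vw mulr0 oppr0 scale0r.
Qed.

(* The component z of v orthogonal to x and y gives a vector u with
   u = x y z in the Clifford algebra; squaring, -|u|^2 = |x|^2 |y|^2 |z|^2. *)
Lemma clifford_christoffel (l : R) x y v w : 0 < l ->
  dot x x = l -> dot y y = l -> dot x y = 0 ->
  clifford_vec x * clifford_vec w = clifford_vec y * clifford_vec v ->
  exists a b : R, v = a *: x + b *: y /\ w = b *: x - a *: y.
Proof.
move=> l0 xx yy xy xwyv; have l_neq0 : l != 0 by rewrite gt_eqF.
pose a := dot v x / l; pose b := dot v y / l; exists a, b.
pose z := v - (a *: x + b *: y).
have xz : dot x z = 0.
  by rewrite /z !dotE xx xy /a (dotC x v); field.
have yz : dot y z = 0.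
  by rewrite /z !dotE yy (dotC y x) xy /b (dotC y v); field.
have vE : v = z + (a *: x + b *: y) by rewrite subrK.
(* Multiplying x w = y v by x on the left gives - l w = x y v; u is what remains after moving over
   the contribution x y (a x + b y) = a l y - b l x of the tangential part of v. *)
pose u := - l *: w - (a * l) *: y + (b * l) *: x.
pose c := @clifford_vec R n.
have cy_x : c y * c x = - (c x * c y) by rewrite clifford_vec_anticomm // dotC.
have cz_x : c z * c x = - (c x * c z) by rewrite clifford_vec_anticomm // dotC.
have cz_y : c z * c y = - (c y * c z) by rewrite clifford_vec_anticomm // dotC.
have cxx : c x * c x = - l *: 1 by rewrite clifford_vec_sqr xx.
have cyy : c y * c y = - l *: 1 by rewrite clifford_vec_sqr yy.
have uE : c u = c x * c y * c z.
  have : c x * (c x * c w) = c x * (c y * c v) by rewrite xwyv.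
  rewrite mulrA cxx -scalerAl mul1r => lw.
  have -> : c u = - l *: c w - (a * l) *: c y + (b * l) *: c x.
    by rewrite /c /u !clifford_vecE.
  rewrite lw; have -> : c v = c z + (a *: c x + b *: c y) by rewrite /c {1}vE
    !clifford_vecE.
  rewrite !mulrDr -!scalerAr cy_x cyy.
  rewrite mulrN !mulrA cxx -scalerAl mul1r -scalerAr mulr1.
  rewrite !scaleNr opprK !scalerN !scalerA.
  by rewrite addrA [X in X + _]addrAC addrK subrK.
have uu : c u * c u = (l ^+ 2 * dot z z) *: 1.
  have czz : c z * c z = - dot z z *: 1 by rewrite clifford_vec_sqr.
  rewrite uE; have -> : c x * c y * c z * (c x * c y * c z) =
      - ((c x * c x) * (c y * c y) * (c z * c z)).
    rewrite -[c x * c y * c z * _]mulrA [c z * _]mulrA [c z * _]mulrA cz_x.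
    rewrite mulNr -(mulrA (c x) (c z)) cz_y mulrN opprK.
    rewrite !mulrA -(mulrA (c x) (c y)) cy_x mulrN !mulNr !mulrA; congr (- _).
  have sM (k k' : R) : k%:A * k'%:A = (k * k')%:A :> clifford R n.
    by rewrite -scalerAl mul1r scalerA.
  by rewrite cxx cyy czz !sM -scaleNr; congr (_ *: _); ring.
move: uu; rewrite clifford_vec_sqr => /eqP; rewrite -subr_eq0 -scalerBl.
rewrite scaler_eq0 oner_eq0 orbF => /eqP uz.
have := dot_ge0 u; have := dot_ge0 z => z0 u0.
have lz0 : 0 <= l ^+ 2 * dot z z by rewrite mulr_ge0 // sqr_ge0.
move: uz => /eqP; rewrite -opprD oppr_eq0 paddr_eq0 // dot_eq0 => /andP[/eqP
  {}u0].
rewrite mulf_eq0 expf_eq0 (negPf l_neq0) dot_eq0 => /eqP {}z0.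
split; first by rewrite {1}vE z0 add0r.
apply: (scalerI l_neq0); apply/eqP; rewrite -subr_eq0 -oppr_eq0 -u0 /u.
rewrite scalerBr !scalerA opprB scaleNr (mulrC l a) (mulrC l b).
by rewrite addrC addrA addrAC.
Qed.

(** Converse of [clifford_christoffel]. By bilinearity only the pair (1, 0), (0, 1) matters; there
    the a-terms cancel since x and y anticommute, the b-terms since x and y have the same square. *)
Lemma wedge_christoffel (f fc : R * R -> 'rV[R]_n) (a b : R) :
  (forall X, f X = X.1 *: f (1, 0) + X.2 *: f (0, 1)) ->
  (forall X, fc X = X.1 *: fc (1, 0) + X.2 *: fc (0, 1)) ->
  dot (f (1, 0)) (f (1, 0)) = dot (f (0, 1)) (f (0, 1)) ->
  dot (f (1, 0)) (f (0, 1)) = 0 ->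
  fc (1, 0) = a *: f (1, 0) + b *: f (0, 1) ->
  fc (0, 1) = b *: f (1, 0) - a *: f (0, 1) ->
  forall X Y, wedge f fc X Y = 0.
Proof.
move=> fE fcE; move: (f (1, 0)) (f (0, 1)) fE => x y fE xx xy xcE ycE X Y.
pose c := @clifford_vec R n.
have k0 : c x * c (fc (0, 1)) = c y * c (fc (1, 0)).
  rewrite xcE ycE /c !clifford_vecE -/c.
  rewrite !mulrDr !mulrN -!scalerAr.
  have -> : c y * c x = - (c x * c y) by rewrite clifford_vec_anticomm // dotC.
  have -> : c x * c x = c y * c y by rewrite /c !clifford_vec_sqr xx.
  by rewrite scalerN addrC.
rewrite /wedge !fE !(fcE X) !(fcE Y) !clifford_vecD !clifford_vecZ -/c.
rewrite !mulrDr !mulrDl -!scalerAl -!scalerAr !scalerA -/c k0.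
apply/eqP; rewrite subr_eq0; apply/eqP.
by rewrite ![Y.1 * _]mulrC ![Y.2 * _]mulrC addrACA.
Qed.

End CliffordVectors.

Lemma linear_comb (K : nzRingType) (U V : lmodType K) (P : U -> V) :
  linear P -> forall a b x y, P (a *: x + b *: y) = a *: P x + b *: P y.
Proof.
move=> Pl a b x y; rewrite Pl; congr (_ + _).
have P0 : P 0 = 0.
  by have := Pl (-1) 0 0; rewrite scaler0 addr0 scaleN1r addNr.
by rewrite -[b *: y]addr0 Pl P0 addr0.
Qed.

Lemma linear_planeE (R : numFieldType) (V : lmodType R) (h : R * R -> V) :
  linear h -> forall X, h X = X.1 *: h (1, 0) + X.2 *: h (0, 1).
Proof.
move=> hl [x y] /=; rewrite -(linear_comb hl); congr (h _).
by apply/pair_equal_spec; rewrite /= /GRing.scale /= !mulr1 !mulr0 addr0 add0r.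
Qed.

Section Pointwise.
Context (R : realType) (n : nat).
Implicit Types (a b f fc g gc : R * R -> 'rV[R]_n).

(** Shows that [part20] depends only on four real inner products, hence is unchanged when these are
    preserved. *)
Lemma part20E a b : part20 a b =
  4^-1 * (real_complex R (dot (a (1, 0)) (b (1, 0)) - dot (a (0, 1)) (b (0, 1)))
   - 'i%C * real_complex R
      (dot (a (1, 0)) (b (0, 1)) + dot (a (0, 1)) (b (1, 0)))).
Proof.
have dmap (u v : 'rV[R]_n) :
    dot (map_mx (real_complex R) u) (map_mx (real_complex R) v) =
    real_complex R (dot u v).
  by rewrite /dot rmorph_sum; apply: eq_bigr => i _; rewrite !mxE rmorphM.
rewrite /part20 /at_dz !dotE !dmap rmorphB rmorphD /=.
set p := (dot (a (1, 0)) (b (1, 0)))%:C%C.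
set q := (dot (a (0, 1)) (b (0, 1)))%:C%C.
set r := (dot (a (1, 0)) (b (0, 1)))%:C%C.
set s := (dot (a (0, 1)) (b (1, 0)))%:C%C.
have ii : 'i%C * 'i%C = -1 :> R[i] by rewrite -expr2 complex.sqr_i.
have -> : p - q = p + ('i%C * 'i%C) * q by rewrite ii mulN1r.
by field.
Qed.

(** All the algebra of the theorem at one point; P is to be [cpsi L] at the image of that point and
    m the denominator there. The factors m^-2 and m^2 cancel in [dot (g X) (gc Y)]. *)
Lemma isothermic_pointwise f fc g gc (P : 'rV[R]_n -> 'rV[R]_n) (l m : R) :
  linear f -> linear fc -> linear P -> 0 < l -> m != 0 ->
  (forall X Y, dot (f X) (f Y) = l * (X.1 * Y.1 + X.2 * Y.2)) ->
  (forall X Y, dot (P X) (P Y) = m ^+ 2 * dot X Y) ->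
  (forall X, g X = m ^- 2 *: P (f X)) -> (forall X, gc X = P (fc X)) ->
  (forall X Y, wedge f fc X Y = 0) ->
  [/\ injective g,
      exists2 l' : R, 0 < l' & forall X Y : R * R,
        dot (g X) (g Y) = l' * (X.1 * Y.1 + X.2 * Y.2),
      forall X Y, wedge g gc X Y = 0 &
      part20 g gc = part20 f fc].
Proof.
move=> f_lin fc_lin P_lin l0 m0 f_conf P_conf gE gcE fw.
have g_lin : linear g.
  by move=> k X Y; rewrite !gE f_lin P_lin scalerDr !scalerA mulrC.
have gc_lin : linear gc by move=> k X Y; rewrite !gcE fc_lin P_lin.
have l'0 : 0 < l / m ^+ 2.
  by rewrite divr_gt0 // lt_def sqr_ge0 expf_neq0.
have g_conf (X Y : R * R) :
    dot (g X) (g Y) = l / m ^+ 2 * (X.1 * Y.1 + X.2 * Y.2).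
  by rewrite !gE !dotE P_conf f_conf; field.
have ggc X Y : dot (g X) (gc Y) = dot (f X) (fc Y).
  by rewrite gE gcE dotE P_conf; field.
split.
- move=> X Y gXY; have gXY0 : g (1 *: X + (-1) *: Y) = 0.
    by rewrite linear_comb // gXY scale1r scaleN1r subrr.
  have /eqP := g_conf (1 *: X + (-1) *: Y) (1 *: X + (-1) *: Y).
  rewrite gXY0 dot0l eq_sym mulf_eq0 gt_eqF //= scale1r scaleN1r.
  rewrite -!expr2 paddr_eq0 ?sqr_ge0 // !sqrf_eq0 => /andP[/eqP h1 /eqP h2].
  rewrite [X]surjective_pairing [Y]surjective_pairing.
  apply/pair_equal_spec; split; apply/eqP; rewrite -subr_eq0; apply/eqP.
    by rewrite -h1 ?scale1r ?scaleN1r.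
  by rewrite -h2 scale1r scaleN1r.
- by exists (l / m ^+ 2).
- have xx := f_conf (1, 0) (1, 0); have yy := f_conf (0, 1) (0, 1).
  have xy := f_conf (1, 0) (0, 1); rewrite /= in xx yy xy.
  (* Applying P to the relations between fc and f, and using P f = m^2 g, turns the coefficients a,
     b into m^2 a, m^2 b. *)
  have [||||a [b [xcE ycE]]] := @clifford_christoffel R n l (f (1, 0))
      (f (0, 1)) (fc (1, 0)) (fc (0, 1)) l0.
  + by rewrite xx; ring.
  + by rewrite yy; ring.
  + by rewrite xy; ring.
  + by apply/eqP; rewrite -subr_eq0; apply/eqP; exact: fw.
  apply: (@wedge_christoffel _ _ _ _ (m ^+ 2 * a) (m ^+ 2 * b)).
  + exact: linear_planeE.
  + exact: linear_planeE.
  + by rewrite !g_conf /=; ring.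
  + by rewrite g_conf /=; ring.
  + rewrite gcE xcE linear_comb // !gE !scalerA; congr (_ *: _ + _ *: _);
      by field.
  + rewrite gcE ycE -scaleNr linear_comb // !gE !scalerA -scaleNr.
    by congr (_ *: _ + _ *: _); field.
- by rewrite !part20E !ggc.
Qed.

End Pointwise.

(** * Smooth functions on the plane *)

Lemma differentiable_eps (R : numFieldType) (V W : normedModType R)
    (f : V -> W) (df : {linear V -> W}) (x : V) : continuous df ->
  (forall e : R, 0 < e ->
    \forall h \near 0, `|f (h + x) - (f x + df h)| <= e * `|h|) ->
  differentiable f x /\ 'd f x = df :> (V -> W).
Proof.
move=> cdf h.
have fE : f \o shift x = cst (f x) + df +o_ 0 id by apply/eqaddoP => e;
  exact: h.
have dE := diff_unique cdf fE; split=> //.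
by apply/diff_locallyP; rewrite dE.
Qed.

Lemma near_eq_differentiable (R : numFieldType) (V W : normedModType R)
    (f g : V -> W) (x : V) : (\near x, f x = g x) -> differentiable f x ->
  differentiable g x /\ 'd g x = 'd f x :> (V -> W).
Proof.
move=> fg df; apply: differentiable_eps; first exact: diff_continuous.
move=> e e0; have /diff_locallyP[_ /eqaddoP/(_ e e0)] := df.
have := fg; rewrite (near_shift 0) subr0.
apply: filterS2 => h; rewrite /= => <-.
by rewrite -(nbhs_singleton fg).
Qed.

Section Smooth.
Context (R : realType).
Implicit Types (V : normedModType R) (D E : set (R * R)) (k : nat).

(** [class_C] for any normed target: the calculus below passes through real-valued coordinates and
    denominators. *)
Fixpoint smooth V k D (F : R * R -> V) : Prop :=
  if k is k'.+1 then
    [/\ forall x, D x -> differentiable F x,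
        smooth k' D ('D_(1, 0) F) & smooth k' D ('D_(0, 1) F)]
  else forall x, D x -> {for x, continuous F}.

Lemma class_C_smooth n k D (F : R * R -> 'rV[R]_n) :
  class_C k D F <-> smooth k D F.
Proof.
by elim: k F => [//|k IH] F /=; split=> -[? /IH ? /IH ?]; split.
Qed.

Lemma smooth_sub V k D E (F : R * R -> V) :
  E `<=` D -> smooth k D F -> smooth k E F.
Proof.
move=> ED; elim: k F => [|k IH] F /=; first by move=> h x /ED; exact: h.
by case=> h /IH ? /IH ?; split=> // x /ED; exact: h.
Qed.

(** As D is open, equality on D is equality near each point of D and so passes to derivatives. Every
    rule below uses this, since the formula for the derivative is established only on D. *)
Lemma smooth_ext V k D (F G : R * R -> V) : open D -> {in D, F =1 G} ->
  smooth k D F -> smooth k D G.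
Proof.
move=> oD; have nFG (F' G' : R * R -> V) x : {in D, F' =1 G'} -> D x ->
    \near x, F' x = G' x.
  move=> FG Dx; have := open_nbhs_nbhs (conj oD Dx).
  by apply: filterS => y /mem_set; exact: FG.
elim: k F G => [|k IH] F G FG /=.
  move=> h x Dx; have := h x Dx; rewrite /prop_for /continuous_at => Fx.
  rewrite -(FG x (mem_set Dx)); apply: cvg_trans Fx.
  by apply: near_eq_cvg; apply: nFG Dx => y yD; rewrite FG.
case=> h F1 F2; split.
- by move=> x Dx; have [] := near_eq_differentiable (nFG F G x FG Dx) (h x Dx).
- apply: IH F1 => x /set_mem Dx; exact/near_eq_derive/nFG.
- apply: IH F2 => x /set_mem Dx; exact/near_eq_derive/nFG.
Qed.

Lemma smoothW V k D (F : R * R -> V) : smooth k.+1 D F -> smooth k D F.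
Proof.
elim: k F => [|k IH] F; first by case=> h _ _ x /h /differentiable_continuous.
by case=> h F1 F2; split; [exact: h|exact: IH F1|exact: IH F2].
Qed.

Lemma smooth_cst V k D (v : V) : smooth k D (fun=> v).
Proof.
elim: k v => [|k IH] v /=; first by move=> x _; exact: cvg_cst.
have D0 (u : R * R) : 'D_u (fun=> v) = (fun=> 0 : V).
  by apply/funext => x; exact: derive_cst.
by split; rewrite ?D0 // => x _; exact: differentiable_cst.
Qed.

Lemma smoothD V k D (F G : R * R -> V) : open D ->
  smooth k D F -> smooth k D G -> smooth k D (fun x => F x + G x).
Proof.
move=> oD; elim: k F G => [|k IH] F G /=.
  by move=> hF hG x Dx; exact: cvgD (hF x Dx) (hG x Dx).
move=> [hF F1 F2] [hG G1 G2]; split.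
- by move=> x Dx; apply: differentiableD; [exact: hF|exact: hG].
- apply: smooth_ext (IH _ _ F1 G1) => // x /set_mem Dx.
  by rewrite -deriveD //; apply: diff_derivable; [exact: hF|exact: hG].
- apply: smooth_ext (IH _ _ F2 G2) => // x /set_mem Dx.
  by rewrite -deriveD //; apply: diff_derivable; [exact: hF|exact: hG].
Qed.

Lemma smooth_sum V k D (I : Type) (r : seq I) (F : I -> R * R -> V) : open D ->
  (forall i, smooth k D (F i)) -> smooth k D (fun x => \sum_(i <- r) F i x).
Proof.
move=> oD h; elim: r => [|i r IH].
  apply: smooth_ext (smooth_cst k D 0) => // x _; by rewrite big_nil.
apply: smooth_ext (smoothD oD (h i) IH) => // x _; by rewrite big_cons.
Qed.

Lemma smoothM k D (F G : R * R -> R) : open D ->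
  smooth k D F -> smooth k D G -> smooth k D (fun x => F x * G x).
Proof.
move=> oD; elim: k F G => [|k IH] F G.
  by move=> hF hG x Dx; exact: cvgM (hF x Dx) (hG x Dx).
(* The product rule multiplies a C^k derivative by an undifferentiated factor, which must first be
   lowered to C^k. *)
move=> sF sG; have := (smoothW sF, smoothW sG) => -[sF' sG'].
case: sF sG => [hF F1 F2] [hG G1 G2]; split.
- by move=> x Dx; apply: differentiableM; [exact: hF|exact: hG].
- apply: smooth_ext (smoothD oD (IH _ _ sF' G1) (IH _ _ sG' F1)) => // x.
  move=> /set_mem Dx.
  by rewrite -deriveM //; apply: diff_derivable; [exact: hF|exact: hG].
- apply: smooth_ext (smoothD oD (IH _ _ sF' G2) (IH _ _ sG' F2)) => // x.
  move=> /set_mem Dx.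
  by rewrite -deriveM //; apply: diff_derivable; [exact: hF|exact: hG].
Qed.

Lemma smoothZ V k D (F : R * R -> R) (v : V) : open D ->
  smooth k D F -> smooth k D (fun x => F x *: v).
Proof.
move=> oD; elim: k F => [|k IH] F.
  by move=> hF x Dx; apply: cvgZl; exact: hF.
have dZ (u x : R * R) : differentiable F x ->
    'D_u (fun x => F x *: v) x = 'D_u F x *: v.
  move=> dF; rewrite !deriveE //; last exact: differentiableZl.
  by rewrite diffZl.
case=> [hF F1 F2]; split.
- by move=> x Dx; apply: differentiableZl; exact: hF.
- by apply: smooth_ext (IH _ F1) => // x /set_mem Dx; rewrite dZ //; exact: hF.
- by apply: smooth_ext (IH _ F2) => // x /set_mem Dx; rewrite dZ //; exact: hF.
Qed.

Lemma smoothV k D (F : R * R -> R) : open D -> (forall x, D x -> F x != 0) ->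
  smooth k D F -> smooth k D (fun x => (F x)^-1).
Proof.
move=> oD F0; elim: k => [|k IH].
  by move=> hF x Dx; apply: cvgV (hF x Dx); exact: F0.
move=> sF; have {}IH := IH (smoothW sF).
have dV (u x : R * R) : D x -> derivable F x u ->
    - 1 * ((F x)^-1 * (F x)^-1 * 'D_u F x) = 'D_u (fun x => (F x)^-1) x.
  by move=> Dx dF; rewrite deriveV ?F0 // mulN1r scaleNr -invfM.
case: sF => [hF F1 F2]; split.
- by move=> x Dx; apply: differentiableV; [exact: hF|exact: F0].
- have := smoothM oD (smooth_cst k D (-1 : R)) (smoothM oD (smoothM oD IH IH)
  F1).
  apply: smooth_ext => // x /set_mem Dx.
  by rewrite dV //; exact/diff_derivable/hF.
- have := smoothM oD (smooth_cst k D (-1 : R)) (smoothM oD (smoothM oD IH IH)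
  F2).
  apply: smooth_ext => // x /set_mem Dx.
  by rewrite dV //; exact/diff_derivable/hF.
Qed.

Lemma smooth_coord n k D (F : R * R -> 'rV[R]_n) j : open D ->
  smooth k D F -> smooth k D (fun x => F x 0 j).
Proof.
move=> oD; elim: k F => [|k IH] F.
  move=> hF x Dx; apply: (@continuous_comp _ _ _ F (fun v : 'rV_n => v 0 j)).
    exact: hF.
  exact: coord_continuous.
case=> hF F1 F2; split.
- move=> x Dx; apply: (@differentiable_comp _ _ _ _ F (fun v : 'rV_n => v 0 j)).
    exact: hF.
  exact: differentiable_coord.
- apply: smooth_ext (IH _ F1) => // x /set_mem Dx.
  by rewrite derive_mx ?mxE //; exact/diff_derivable/hF.
- apply: smooth_ext (IH _ F2) => // x /set_mem Dx.
  by rewrite derive_mx ?mxE //; exact/diff_derivable/hF.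
Qed.

Lemma smooth_rV n k D (F : R * R -> 'rV[R]_n) : open D ->
  (forall j, smooth k D (fun x => F x 0 j)) -> smooth k D F.
Proof.
move=> oD h; apply: smooth_ext (smooth_sum (index_enum 'I_n) oD
    (fun j => smoothZ (delta_mx 0 j : 'rV[R]_n) oD (h j))) => // x _.
by rewrite -row_sum_delta.
Qed.

End Smooth.

(** * Closed forms on a rectangle *)

Section Integral.
Context (R : realType).
Implicit Types (f : R -> R) (a b c d x y : R) (F : R * R -> R).
Local Notation mu := (@lebesgue_measure R).

Lemma is_derive_slice1 F x y :
  derivable F (x, y) (1, 0) ->
  is_derive x 1 (fun s => F (s, y)) ('D_(1, 0) F (x, y)).
Proof.
have e : (fun h : R => h^-1 *: (((fun s => F (s, y)) \o shift x) (h *: 1) -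
    F (x, y))) =
    (fun h : R => h^-1 *: ((F \o shift (x, y)) (h *: (1, 0)) - F (x, y))).
  apply/funext => h /=; congr (_ *: (F _ - _)).
  by apply/pair_equal_spec; rewrite /= scaler0 add0r.
by move=> dF; split; rewrite /derivable /derive /= e.
Qed.

Lemma is_derive_slice2 F x y :
  derivable F (x, y) (0, 1) ->
  is_derive y 1 (fun t => F (x, t)) ('D_(0, 1) F (x, y)).
Proof.
have e : (fun h : R => h^-1 *: (((fun t => F (x, t)) \o shift y) (h *: 1) -
    F (x, y))) =
    (fun h : R => h^-1 *: ((F \o shift (x, y)) (h *: (0, 1)) - F (x, y))).
  apply/funext => h /=; congr (_ *: (F _ - _)).
  by apply/pair_equal_spec; rewrite /= scaler0 add0r.
by move=> dF; split; rewrite /derivable /derive /= e.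
Qed.

Lemma continuous_slice1 F x y :
  {for (x, y), continuous F} -> {for x, continuous (fun s => F (s, y))}.
Proof.
move=> cF; apply: (@continuous_comp _ _ _ (fun s => (s, y)) F) => //.
by apply: (@cvg_pair R R R (nbhs x) (nbhs x) (nbhs y));
  [exact: cvg_id|exact: cvg_cst].
Qed.

Lemma continuous_slice2 F x y :
  {for (x, y), continuous F} -> {for y, continuous (fun t => F (x, t))}.
Proof.
move=> cF; apply: (@continuous_comp _ _ _ (fun t => (x, t)) F) => //.
by apply: (@cvg_pair R R R (nbhs y) (nbhs x) (nbhs y));
  [exact: cvg_cst|exact: cvg_id].
Qed.

Lemma integrable_segment f a b : {in `[a, b], continuous f} ->
  mu.-integrable `[a, b] (EFin \o f).
Proof.
move=> cf; apply: continuous_compact_integrable; first exact: segment_compact.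
by apply: continuous_in_subspaceT => x /set_mem; exact: cf.
Qed.

Lemma is_derive_Rintegral f a b x : x \in `]a, b[ ->
  {in `[a, b], continuous f} ->
  is_derive x 1 (fun x => \int[mu]_(t in `[a, x]) f t) (f x).
Proof.
rewrite in_itv /= => /andP[ax xb] cf.
have [|dF <-] := continuous_FTC1_closed xb (integrable_segment cf) ax.
  by apply: cf; rewrite in_itv /= !ltW.
by rewrite derive1E; exact: DeriveDef.
Qed.

Lemma Rintegral_derive f (f' : R -> R) a b : a < b ->
  {in `[a, b], forall x, is_derive x 1 f (f' x)} ->
  {in `[a, b], continuous f'} ->
  \int[mu]_(t in `[a, b]) f' t = f b - f a.
Proof.
move=> ab df cf'; have df' x : a <= x <= b -> is_derive x 1 f (f' x).
  by move=> h; apply: df; rewrite in_itv.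
have cf x : a <= x <= b -> {for x, continuous f}.
  by move=> /df'[? _]; apply: differentiable_continuous; exact/derivable1_diffP.
rewrite /Rintegral (@continuous_FTC2 _ f' f) //.
- by apply: continuous_in_subspaceT => x /set_mem; exact: cf'.
- split.
  + by move=> x /subset_itv_oo_cc /df[].
  + by apply: cvg_at_right_filter; apply: cf; rewrite lexx ltW.
  + by apply: cvg_at_left_filter; apply: cf; rewrite lexx ltW.
- by move=> x /subset_itv_oo_cc /df[_ <-]; rewrite derive1E.
Qed.

(** Differentiation under the integral sign by domination: the x-derivative is continuous on a
    compact rectangle, so a constant dominates it. *)
Lemma is_derive_Rintegral_param F (D : set (R * R)) a b c d x :
  (forall z, D z -> derivable F z (1, 0)) ->
  (forall z, D z -> {for z, continuous F}) ->
  (forall z, D z -> {for z, continuous ('D_(1, 0) F)}) ->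
  `[a, b] `*` `[c, d] `<=` D -> x \in `]a, b[ ->
  is_derive x 1 (fun x => \int[mu]_(t in `[c, d]) F (x, t))
    (\int[mu]_(t in `[c, d]) 'D_(1, 0) F (x, t)).
Proof.
move=> dF cF cdF abD xab.
(* The extreme value theorem below needs a nonempty rectangle. Over an empty segment both integrals
   are 0. *)
have [cd|dc] := leP c d; last first.
  have e0 : `[c, d]%classic = set0.
    by apply/seteqP; split => // t /=; rewrite in_itv /= => /andP[h /(le_trans
      h)]; rewrite leNgt dc.
  rewrite e0.
  have -> : (fun x => \int[mu]_(t in set0) F (x, t)) = cst 0.
    by apply/funext => s; rewrite Rintegral_set0.
  rewrite Rintegral_set0; exact: is_derive_cst.
have abK s : `]a, b[%classic s -> s \in `[a, b].
  by rewrite /= !in_itv /= => /andP[? ?]; rewrite !ltW.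
have dF1 s t : `]a, b[%classic s -> `[c, d]%classic t ->
    is_derive s 1 (fun s => F (s, t)) ('D_(1, 0) F (s, t)).
  move=> /abK hs ht; apply: is_derive_slice1; apply: dF; apply: abD.
  by split.
have [M M0 FM] : exists2 M : R, 0 <= M & forall s t,
    `]a, b[%classic s -> `[c, d]%classic t -> `|'D_(1, 0) F (s, t)| <= M.
  have [||z _ zM] := @compact_EVT_max _ R (fun z => `|'D_(1, 0) F z|)
    (`[a, b] `*` `[c, d])%classic _ (compact_setX (@segment_compact _ a b)
      (@segment_compact _ c d)).
  - by exists (x, c); split; [exact: abK|rewrite /= in_itv /= lexx].
  - apply: continuous_in_subspaceT => z /set_mem /abD Dz.
    exact: cvg_norm (cdF z Dz).
  - exists `|'D_(1, 0) F z| => // s t hs ht.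
    by apply: (zM (s, t)); apply/mem_set; split => //; exact: abK.
pose f s t := F (s, t).
have pf s t : `]a, b[%classic s -> `[c, d]%classic t ->
    partial1of2 f s t = 'D_(1, 0) F (s, t).
  by move=> hs ht; rewrite partial1of2E; have [_ ->] := dF1 _ _ hs ht.
have intf s : `]a, b[%classic s -> mu.-integrable `[c, d] (EFin \o f s).
  move=> /abK hs; apply: integrable_segment => t ht.
  by apply: continuous_slice2; apply: cF; apply: abD; split.
have der s t : `]a, b[%classic s -> `[c, d]%classic t ->
    derivable (f^~ t) s 1.
  by move=> hs ht; have [] := dF1 _ _ hs ht.
have intM : mu.-integrable `[c, d] (EFin \o (fun=> M)).
  by apply: integrable_segment => t _; exact: cvg_cst.
have bM s t : `]a, b[%classic s -> `[c, d]%classic t ->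
    `|partial1of2 f s t| <= M.
  by move=> hs ht; rewrite pf //; exact: FM.
have M0' (t : R) : 0 <= M by [].
have h1 := @derivable_under_integral R _ _ mu f _ (measurable_itv `[c, d]) _ _
  _ xab intf der
  _ M0' intM bM.
have h2 := @differentiation_under_integral R _ _ mu f _ (measurable_itv `[c,
  d]) _ _ _ xab intf der
  _ M0' intM bM.
apply: DeriveDef; first exact: h1.
rewrite -derive1E h2; apply: eq_Rintegral => t /set_mem ht.
exact: pf.
Qed.

End Integral.

Section PlaneForm.
Context (R : realType) (V : normedModType R) (p q : V).

Definition plane_form (X : R * R) : V := X.1 *: p + X.2 *: q.

Lemma plane_form_linear : linear plane_form.
Proof.
move=> k X Y; rewrite /plane_form /= !scalerDl scalerDr !scalerA.
by rewrite -!addrA; congr (_ + _); rewrite addrCA.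
Qed.

HB.instance Definition _ := GRing.isLinear.Build R (R * R)%type V *:%R
  plane_form plane_form_linear.

Lemma plane_form_continuous : continuous plane_form.
Proof.
move=> X; apply: cvgD; apply: cvgZl; first exact: cvg_fst.
exact: cvg_snd.
Qed.

End PlaneForm.

Lemma open_setX (T U : topologicalType) (A : set T) (B : set U) :
  open A -> open B -> open (A `*` B).
Proof.
move=> oA oB; rewrite openE => -[x y] [Ax By].
by exists (A, B); first by split; exact: open_nbhs_nbhs.
Qed.

Section Poincare.
Context (R : realType).
Implicit Types (a b c d x y : R) (F p q h : R * R -> R) (D : set (R * R)).
Local Notation mu := (@lebesgue_measure R).

(** The mean value theorem for an increment k of either sign, as the components of a plane increment
    have no fixed sign. *)
Lemma MVT_centered (f df : R -> R) x (k : R) :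
  (forall s, `|s - x| <= `|k| -> is_derive s 1 f (df s)) ->
  exists2 s, `|s - x| <= `|k| & f (k + x) - f x = df s * k.
Proof.
move=> dfs; have df' a b : a <= b -> (forall s, s \in `[a, b] -> `|s - x| <=
  `|k|) ->
    exists2 s, s \in `[a, b] & f b - f a = df s * (b - a).
  move=> ab abx; apply: MVT_segment => //.
    move=> s; rewrite in_itv /= => /andP[? ?].
    by apply: dfs; apply: abx; rewrite in_itv /= !ltW.
  apply: derivable_within_continuous => s /abx /dfs; by case.
have [k0|k0] := leP 0 k.
  have [||s sx ->] := df' x (k + x).
  - by rewrite lerDr.
  - by move=> s; rewrite in_itv /= ler_norml ger0_norm // => /andP[? ?];
    apply/andP; split; lra.
  exists s; last by rewrite addrK.
  by move: sx; rewrite in_itv /= ler_norml ger0_norm // => /andP[? ?];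
    apply/andP; split; lra.
have [||s sx e] := df' (k + x) x.
- by rewrite gerDr ltW.
- by move=> s; rewrite in_itv /= ler_norml ltr0_norm // => /andP[? ?];
  apply/andP; split; lra.
exists s; last by rewrite -opprB e; ring.
by move: sx; rewrite in_itv /= ler_norml ltr0_norm // => /andP[? ?];
  apply/andP; split; lra.
Qed.

(** The increment is split along a horizontal and a vertical segment. The mean value theorem on each
    leaves an error governed by the oscillation of p and q near z. *)
Lemma differentiable_partials h p q D : open D ->
  (forall z, D z -> {for z, continuous p}) ->
  (forall z, D z -> {for z, continuous q}) ->
  (forall x y, D (x, y) -> is_derive x 1 (fun s => h (s, y)) (p (x, y))) ->
  (forall x y, D (x, y) -> is_derive y 1 (fun t => h (x, t)) (q (x, y))) ->
  forall z, D z ->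
    [/\ differentiable h z, 'D_(1, 0) h z = p z & 'D_(0, 1) h z = q z].
Proof.
move=> oD cp cq dp dq z Dz.
have [dh dE] : differentiable h z /\ 'd h z = plane_form (p z) (q z) :> (_ ->
  _).
  apply: differentiable_eps; first exact: plane_form_continuous.
  move=> e e0; have e20 : 0 < e / 2 by rewrite divr_gt0.
  have : \forall w \near z, [/\ D w, `|p z - p w| <= e / 2 & `|q z - q w| <= e
    / 2].
    have nD := open_nbhs_nbhs (conj oD Dz).
    have /cvgrPdist_le/(_ _ e20) np := cp z Dz.
    have /cvgrPdist_le/(_ _ e20) nq := cq z Dz.
    by near=> w; split; near: w.
  move=> /nbhs_ballP[r /= r0 rB]; near=> k.
  have kr : `|k| < r.
    near: k; exact: (@nbhs0_lt R (R * R)%type r r0).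
  (* The norm of the plane is the maximum norm, so the whole broken path from z to k + z stays in
     the ball. *)
  have inB (s t : R) : `|s| <= `|k.1| -> `|t| <= `|k.2| ->
      [/\ D (s + z.1, t + z.2), `|p z - p (s + z.1, t + z.2)| <= e / 2
        & `|q z - q (s + z.1, t + z.2)| <= e / 2].
    move=> sk tk; apply: rB; rewrite -ball_normE /ball_ /=.
    move: kr; rewrite !prod_normE /= !gt_max => /andP[k1 k2].
    have -> : z.1 - (s + z.1) = - s by ring.
    have -> : z.2 - (t + z.2) = - t by ring.
    by rewrite !normrN (le_lt_trans sk k1) (le_lt_trans tk k2).
  have [s sk hs] : exists2 s, `|s - z.1| <= `|k.1| &
      h (k.1 + z.1, k.2 + z.2) - h (z.1, k.2 + z.2) =
      p (s, k.2 + z.2) * k.1.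
    apply: (@MVT_centered (fun s => h (s, k.2 + z.2))
      (fun s => p (s, k.2 + z.2))).
    move=> s sk; apply: dp.
    by have [] := inB (s - z.1) k.2 sk (lexx _); rewrite subrK.
  have k0 : `|0 : R| <= `|k.1| by rewrite normr0.
  have [t tk ht] : exists2 t, `|t - z.2| <= `|k.2| &
      h (z.1, k.2 + z.2) - h (z.1, z.2) = q (z.1, t) * k.2.
    apply: (@MVT_centered (fun t => h (z.1, t)) (fun t => q (z.1, t))).
    move=> t tk; apply: dq.
    by have [] := inB 0 (t - z.2) k0 tk; rewrite add0r subrK.
  have [_ ps _] := inB (s - z.1) k.2 sk (lexx _).
  have [_ _ qt] := inB 0 (t - z.2) k0 tk.
  move: ps qt; rewrite add0r !subrK => ps qt.
  have -> : h (k + z) - (h z + plane_form (p z) (q z) k) =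
      - ((p z - p (s, k.2 + z.2)) * k.1 + (q z - q (z.1, t)) * k.2).
    rewrite /plane_form /GRing.scale /=.
    have -> : h (k + z) = h (z.1, z.2) + q (z.1, t) * k.2 + p (s, k.2 + z.2) *
      k.1.
      by rewrite -ht -hs; case: (z) (k) => [? ?] [? ?] /=; ring.
    by rewrite -surjective_pairing; ring.
  rewrite normrN (le_trans (ler_normD _ _)) // !normrM.
  have k1 : `|k.1| <= `|k| by rewrite prod_normE le_max lexx.
  have k2 : `|k.2| <= `|k| by rewrite prod_normE le_max lexx orbT.
  rewrite (splitr e) mulrDl lerD // ler_pM //.
by rewrite !deriveE // dE /plane_form /= !scale1r !scale0r addr0 add0r.
Unshelve. all: by end_near. Qed.

Lemma closed_rectangle_nbhs D z : open D -> D z -> exists2 e : R, 0 < e &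
  `[z.1 - e, z.1 + e] `*` `[z.2 - e, z.2 + e] `<=` D.
Proof.
move=> oD Dz; have := open_nbhs_nbhs (conj oD Dz).
(* Balls are open squares here; halving the radius leaves room for the closed square. *)
move=> /nbhs_ballP[r /= r0 rB]; exists (r / 2); first by rewrite divr_gt0.
move=> w [/= w1 w2]; apply: rB; rewrite -ball_normE /ball_ /=.
move: w1 w2; rewrite prod_normE /= gt_max !in_itv /= !ltr_norml.
by move=> /andP[? ?] /andP[? ?]; apply/andP; split; apply/andP; split; lra.
Qed.

(** Integrate from the corner (a, c) along the bottom side, then vertically. The y-derivative is q
    at once; the x-derivative is p (x, c) plus the integral of d_1 q = d_2 p over [c, y], that is, p
    (x, y). *)
Lemma poincare p q D a b c d : `[a, b] `*` `[c, d] `<=` D ->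
  smooth 1 D p -> smooth 1 D q ->
  (forall z, D z -> 'D_(0, 1) p z = 'D_(1, 0) q z) ->
  exists h, forall z, (`]a, b[ `*` `]c, d[) z ->
    [/\ differentiable h z, 'D_(1, 0) h z = p z & 'D_(0, 1) h z = q z].
Proof.
move=> abD sp sq pq.
have cp z : D z -> {for z, continuous p} := smoothW sp z.
have cq z : D z -> {for z, continuous q} := smoothW sq z.
case: sp sq => [dp _ cp2] [dq cq1 _].
have sub x y : x \in `]a, b[ -> y \in `[c, d] -> D (x, y).
  rewrite in_itv /= => /andP[? ?] yc; apply: abD; split => //=.
  by rewrite in_itv /= !ltW.
pose h z := \int[mu]_(s in `[a, z.1]) p (s, c) +
            \int[mu]_(t in `[c, z.2]) q (z.1, t).
exists h; apply: (@differentiable_partials h p q).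
- by apply: open_setX; exact: itv_open.
- move=> z [z1 z2]; apply: cp; rewrite [z]surjective_pairing; apply: sub => //.
  exact: subset_itv_oo_cc z2.
- move=> z [z1 z2]; apply: cq; rewrite [z]surjective_pairing; apply: sub => //.
  exact: subset_itv_oo_cc z2.
- move=> x y [/= xab ycd].
  have [cy yd] : c < y /\ y < d by move: ycd; rewrite in_itv => /andP[].
  have cd : c \in `[c, d] by rewrite in_itv /= lexx ltW ?(lt_trans cy).
  have cyd t : t \in `[c, y] -> t \in `[c, d].
    by rewrite !in_itv /= => /andP[-> /le_trans->] //; exact: ltW.
  have d1 : is_derive x 1 (fun x => \int[mu]_(s in `[a, x]) p (s, c)) (p (x,
    c)).
    apply: (is_derive_Rintegral xab) => s sab.
    by apply: continuous_slice1; apply: cp; apply: abD; split.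
  have cydD : `[a, b] `*` `[c, y] `<=` D.
    by move=> z [z1 z2]; apply: abD; split=> //; exact: cyd.
  have dq' z : D z -> derivable q z (1, 0).
    by move=> Dz; exact/diff_derivable/dq.
  have d2 := is_derive_Rintegral_param dq' cq cq1 cydD xab.
  have e : \int[mu]_(t in `[c, y]) 'D_(1, 0) q (x, t) = p (x, y) - p (x, c).
    have dpx : {in `[c, y], forall t : R, is_derive t 1 (fun t => p (x, t))
        ('D_(0, 1) p (x, t))}.
      by move=> t /cyd td; apply/is_derive_slice2/diff_derivable/dp/sub.
    have cpx : {in `[c, y], continuous (fun t => 'D_(0, 1) p (x, t))}.
      by move=> t /cyd td; apply: (@continuous_slice2 _ ('D_(0, 1) p));
        apply/cp2/sub.
    rewrite -(Rintegral_derive cy dpx cpx).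
    by apply: eq_Rintegral => t /set_mem /cyd td; rewrite pq //; exact: sub.
  by rewrite e in d2; have := is_deriveD d1 d2; rewrite subrKC.
- move=> x y [/= xab ycd].
  have d1 : is_derive y 1 (fun y => \int[mu]_(t in `[c, y]) q (x, t)) (q (x,
    y)).
    apply: (is_derive_Rintegral ycd) => t tcd.
    by apply: continuous_slice2; apply: cq; apply: sub.
  have := is_deriveD (is_derive_cst (\int[mu]_(s in `[a, x]) p (s, c)) y 1) d1.
  by rewrite add0r.
Qed.

(* Differentiate F (x, t) = F (x, c) + int_c^t (d_2 F) (x, r) dr in x under the
   integral sign, then in t. *)
Lemma schwarz F D z : open D -> smooth 2 D F -> D z ->
  'D_(0, 1) ('D_(1, 0) F) z = 'D_(1, 0) ('D_(0, 1) F) z.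
Proof.
move=> oD [dF [dF1 _ _] [dF2 cF21 _]] Dz.
have [e e0 eD] := closed_rectangle_nbhs oD Dz.
case: z Dz eD => x y Dxy /=; set a := x - e; set b := x + e.
set c := y - e; set d := y + e => abD.
have xab : x \in `]a, b[ by rewrite in_itv /= /a /b; apply/andP; split; lra.
have ycd : y \in `]c, d[ by rewrite in_itv /= /c /d; apply/andP; split; lra.
have sub s t : s \in `]a, b[ -> t \in `[c, d] -> D (s, t).
  by move=> /subset_itv_oo_cc ? ?; exact: abD.
have cF2 z : D z -> {for z, continuous ('D_(0, 1) F)}.
  by move=> Dz; exact/differentiable_continuous/dF2.
have dF2' z : D z -> derivable ('D_(0, 1) F) z (1, 0).
  by move=> Dz; exact/diff_derivable/dF2.
have F1E t : t \in `]c, d[ -> 'D_(1, 0) F (x, t) =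
    'D_(1, 0) F (x, c) +
    \int[mu]_(r in `[c, t]) 'D_(1, 0) ('D_(0, 1) F) (x, r).
  rewrite in_itv /= => /andP[ct td].
  have cc : c \in `[c, d] by rewrite in_itv /= lexx ltW ?(lt_trans ct).
  have tcd : t \in `[c, d] by rewrite in_itv /= !ltW.
  have ctd r : r \in `[c, t] -> r \in `[c, d].
    by rewrite !in_itv /= => /andP[-> /le_trans->] //; exact: ltW.
  have FE s : s \in `]a, b[ ->
      F (s, c) + \int[mu]_(r in `[c, t]) 'D_(0, 1) F (s, r) = F (s, t).
    move=> sab.
    have dFs : {in `[c, t], forall r : R, is_derive r 1 (fun t => F (s, t))
        ('D_(0, 1) F (s, r))}.
      by move=> r /ctd rd; apply/is_derive_slice2/diff_derivable/dF/sub.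
    have cFs : {in `[c, t], continuous (fun r => 'D_(0, 1) F (s, r))}.
      by move=> r /ctd rd; apply: (@continuous_slice2 _ ('D_(0, 1) F));
        apply/cF2/sub.
    by rewrite (Rintegral_derive ct dFs cFs) subrKC.
  have d1 : is_derive x 1 (fun s => F (s, c)) ('D_(1, 0) F (x, c)).
    by apply/is_derive_slice1/diff_derivable/dF/sub.
  have d2 : is_derive x 1 (fun s => F (s, t)) ('D_(1, 0) F (x, t)).
    by apply/is_derive_slice1/diff_derivable/dF/sub.
  have ctD : `[a, b] `*` `[c, t] `<=` D.
    by move=> z [z1 z2]; apply: abD; split=> //; exact: ctd.
  have d3 := is_derive_Rintegral_param dF2' cF2 cF21 ctD xab.
  have [_ <-] := d2; have [_ <-] := is_deriveD d1 d3.
  apply: near_eq_derive; apply: filterS (near_in_itvoo xab) => s sab.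
  by rewrite -FE.
have d1 : is_derive y 1 (fun t => 'D_(1, 0) F (x, t))
    ('D_(0, 1) ('D_(1, 0) F) (x, y)).
  by apply/is_derive_slice2/diff_derivable/dF1.
have d2 : is_derive y 1
    (fun t => \int[mu]_(r in `[c, t]) 'D_(1, 0) ('D_(0, 1) F) (x, r))
    ('D_(1, 0) ('D_(0, 1) F) (x, y)).
  apply: (is_derive_Rintegral ycd) => t tcd.
  by apply: (@continuous_slice2 _ ('D_(1, 0) ('D_(0, 1) F))); apply/cF21/sub.
have [_ e3] := is_deriveD (is_derive_cst ('D_(1, 0) F (x, c)) y 1) d2.
rewrite add0r in e3; have [_ <-] := d1; rewrite -e3.
by apply: near_eq_derive; apply: filterS (near_in_itvoo ycd) => t /F1E.
Qed.

End Poincare.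

(** * Complex coordinates *)

Section Complex.
Context (R : realType).
Implicit Types (x y : R * R) (z w : R[i]).

Lemma toCK : cancel (@toC R) (@ofC R). Proof. by case. Qed.
Lemma ofCK : cancel (@ofC R) (@toC R). Proof. by case. Qed.

Lemma ofCB z w : ofC (z - w) = ofC z - ofC w.
Proof. by case: z w => [? ?] []. Qed.

(** The plane carries the maximum norm, so the sharp constant is the square root of 2; the value 2
    is enough. *)
Lemma norm_toC x : `|toC x| <= (2 * `|x|)%:C%C.
Proof.
rewrite normc_def lecR /=.
have x1 : `|x.1| <= `|x| by rewrite prod_normE le_max lexx.
have x2 : `|x.2| <= `|x| by rewrite prod_normE le_max lexx orbT.
have s1 : x.1 ^+ 2 <= `|x| ^+ 2 by rewrite -real_normK ?num_real // lerXn2r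
  ?nnegrE.
have s2 : x.2 ^+ 2 <= `|x| ^+ 2 by rewrite -real_normK ?num_real // lerXn2r
  ?nnegrE.
have x0 : 0 <= `|x| by [].
rewrite -[leRHS]ger0_norm ?mulr_ge0 // -sqrtr_sqr ler_wsqrtr //.
rewrite exprMn; nra.
Qed.

Lemma norm_ofC z : (`|ofC z|)%:C%C <= `|z|.
Proof.
rewrite normc_def lecR prod_normE ge_max /=.
by rewrite -!sqrtr_sqr !ler_wsqrtr ?lerDl ?lerDr ?sqr_ge0.
Qed.

(** Norms on [R[i]] take values in [R[i]], so an epsilon there is a positive complex number. *)
Lemma complex_gt0P (e : R[i]) : 0 < e -> exists2 r : R, 0 < r & e = r%:C%C.
Proof.
by case: e => a b; rewrite ltcE /= => /andP[/eqP -> a0]; exists a.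
Qed.

Lemma toC_continuous : continuous (@toC R).
Proof.
move=> x; apply/cvgrPdist_lt => e /complex_gt0P[r r0 ->]; near=> y.
have -> : toC x - toC y = toC (x - y) by [].
apply: le_lt_trans (norm_toC _) _; rewrite ltcR mulrC -ltr_pdivlMr //.
by near: y; apply: cvgr_dist_lt => //; rewrite divr_gt0.
Unshelve. all: by end_near. Qed.

Lemma ofC_continuous : continuous (@ofC R : R[i]^o -> R * R).
Proof.
move=> z; apply/(@cvgrPdist_lt _ _ _ _ (nbhs_filter (z : R[i]^o))) => e e0.
have e0' : 0 < e%:C%C :> R[i] by rewrite ltcR.
apply: filterS (nbhsx_ballx (z : R[i]^o) _ e0') => w.
rewrite -ball_normE /ball_ /= => zw.
rewrite -ltcR -ofCB.
exact: le_lt_trans (norm_ofC _) zw.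
Qed.

(** If D is the complex derivative, the real differential is multiplication by D, with partial
    derivatives D and D i. *)
Lemma differentiable_holomorphic (f : R[i]^o -> R[i]^o) x :
  derivable f (toC x) 1 -> differentiable (fun y => ofC (f (toC y))) x.
Proof.
set z := toC x.
move=> /cvg_ex[/= D fD].
pose F y := ofC (f (toC y)); pose dF := plane_form (ofC D) (ofC (D * 'i%C)).
suff h (e : R) : 0 < e -> \forall k \near (0 : R * R), `|F (k + x) - (F x + dF
  k)| <= e * `|k|.
  by have [] := differentiable_eps (@plane_form_continuous _ _ _ _) h.
rewrite {}/F {}/dF.
(* Half of e absorbs the factor 2 of [norm_toC]. *)
move=> e0; have e20 : 0 < (e / 2)%:C%C :> R[i] by rewrite ltcR divr_gt0.
have /cvgrPdist_le/(_ _ e20) := fD.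
rewrite /dnbhs near_withinE => nD.
have : \forall k \near (0 : R * R), toC k != 0 ->
    `|D - (toC k)^-1 *: (f (toC k *: 1 + z) - f z)| <= (e / 2)%:C%C.
  exact: (@toC_continuous 0 _ nD).
apply: filterS => k nk.
have [k0|k0] := eqVneq (toC k) 0.
  have -> : k = 0 by rewrite -[k]toCK k0.
  rewrite add0r /plane_form /= !scale0r !addr0 subrr !normr0; lra.
have kz : toC (k + x) = toC k + z by [].
have -> : plane_form (ofC D) (ofC (D * 'i%C)) k = ofC (D * toC k).
  rewrite /plane_form; case: (D) (k) => [a b] [s t] /=.
  congr pair.
    transitivity (s * a + t * (a * 0 - b * 1)); first by [].
    by transitivity (a * s - b * t); [ring|].
  transitivity (s * b + t * (a * 1 + b * 0)); first by [].
  by transitivity (a * t + b * s); [ring|].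
have {}nk := nk k0.
rewrite -lecR kz; set u := f (toC k + z).
rewrite opprD addrA -!ofCB.
apply: le_trans (norm_ofC _) _.
have -> : u - f z - D * toC k = - (toC k * (D - (toC k)^-1 * (u - f z))).
  by field.
rewrite normrN normrM.
have {}nk : `|D - (toC k)^-1 * (u - f z)| <= (e / 2)%:C%C.
  by move: nk; rewrite /u /GRing.scale /= mulr1.
apply: le_trans (ler_pM _ _ (norm_toC k) nk) _ => //.
by rewrite -rmorphM lecR /=; lra.
Qed.

End Complex.

(** * The dual form *)

Section ConeFunctions.
Context (R : realType) (n : nat) (lin : lorentz R n -> R).
Hypothesis lin_linear : forall k u v, lin (k *: u + v) = k * lin u + lin v.
Implicit Types (G H : R * R -> 'rV[R]_n) (D : set (R * R)).

(** Expansion in a basis: [lin] has no continuity hypothesis, and this formula reduces its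
    smoothness and derivatives to those of scalar functions. *)
Lemma linE X p m : lin (X, p, m) =
  \sum_i X 0 i * lin (delta_mx 0 i, 0, 0) + p * lin (0, 1, 0) + m * lin (0, 0,
    1).
Proof.
have lin0 : lin 0 = 0.
  by have := lin_linear (-1) 0 0; rewrite scaler0 addr0 mulN1r addNr.
have linD u v : lin (u + v) = lin u + lin v.
  by rewrite -[u]scale1r lin_linear mul1r scale1r.
have linZ k u : lin (k *: u) = k * lin u.
  by rewrite -[k *: u]addr0 lin_linear lin0 addr0.
have -> : (X, p, m) = (X, 0, 0) + p *: (0, 1, 0) + m *: (0, 0, 1) :> lorentz R
  n.
  apply/pair_equal_spec; split; last first.
    by rewrite /= /GRing.scale /= mulr0 mulr1 !add0r.
  apply/pair_equal_spec; split; first by rewrite /= !scaler0 !addr0.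
  by rewrite /= /GRing.scale /= mulr0 mulr1 addr0 add0r.
rewrite !linD !linZ; congr (_ + _ + _).
pose lam Y := lin (Y, 0, 0).
have lamD : {morph lam : Y Z / Y + Z}.
  move=> Y Z; rewrite /lam -linD; congr lin.
  apply/pair_equal_spec; rewrite /= addr0; split=> //.
  by apply/pair_equal_spec; rewrite /= addr0.
rewrite -[LHS]/(lam X) [in LHS](row_sum_delta X) (big_morph lam lamD lin0).
apply: eq_bigr => i _; rewrite /lam -linZ; congr lin.
apply/pair_equal_spec; rewrite /= scaler0; split=> //.
by apply/pair_equal_spec; rewrite /= scaler0.
Qed.

Lemma smooth_dot k D G H : open D -> smooth k D G -> smooth k D H ->
  smooth k D (fun x => dot (G x) (H x)).
Proof.
move=> oD sG sH; apply: smooth_sum => // i.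
by apply: smoothM => //; apply: smooth_coord.
Qed.

Lemma smooth_lin k D G (p m : R * R -> R) : open D -> smooth k D G ->
  smooth k D p -> smooth k D m -> smooth k D (fun x => lin (G x, p x, m x)).
Proof.
move=> oD sG sp sm.
have s1 : smooth k D (fun x => \sum_i G x 0 i * lin (delta_mx 0 i, 0, 0)).
  apply: smooth_sum => // i; apply: smoothM => //; last exact: smooth_cst.
  exact: smooth_coord.
have s2 : smooth k D (fun x => p x * lin (0, 1, 0)).
  by apply: smoothM => //; exact: smooth_cst.
have s3 : smooth k D (fun x => m x * lin (0, 0, 1)).
  by apply: smoothM => //; exact: smooth_cst.
by apply: smooth_ext (smoothD oD (smoothD oD s1 s2) s3) => // x _;
  rewrite -linE.
Qed.

Lemma smooth_cone k D G : open D -> smooth k D G ->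
  smooth k D (fun x => lin (cone (G x))).
Proof.
move=> oD sG; apply: smooth_lin => //; last exact: smooth_cst.
exact: smooth_dot.
Qed.

Lemma smooth_dcone k D G H : open D -> smooth k D G -> smooth k D H ->
  smooth k D (fun x => lin (dcone (G x) (H x))).
Proof.
move=> oD sG sH; apply: smooth_lin => //; last exact: smooth_cst.
by apply: smoothM => //; [exact: smooth_cst|exact: smooth_dot].
Qed.

Lemma is_derive_coord G x v j : derivable G x v ->
  is_derive x v (fun y => G y 0 j) ('D_v G x 0 j).
Proof.
move=> dG; rewrite derive_mx // mxE.
by apply: DeriveDef => //; exact: (derivable_mxP _ _ _).1 dG 0 j.
Qed.

Lemma is_derive_dot G H x v : derivable G x v -> derivable H x v ->
  is_derive x v (fun y => dot (G y) (H y))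
    (dot ('D_v G x) (H x) + dot (G x) ('D_v H x)).
Proof.
move=> dG dH; rewrite /dot -big_split.
have -> : (fun y => \sum_(i < n) G y 0 i * H y 0 i) =
    \sum_(i < n) (fun y => G y 0 i * H y 0 i).
  by apply/funext => y; rewrite fct_sumE.
apply: is_derive_sum => i.
apply: is_derive_eq (is_deriveM (is_derive_coord i dG) (is_derive_coord i dH))
  _.
by rewrite addrC /GRing.scale /= (mulrC (H x 0 i)).
Qed.

Lemma is_derive_lin G (p m : R * R -> R) (dp dm : R) x v : derivable G x v ->
  is_derive x v p dp -> is_derive x v m dm ->
  is_derive x v (fun y => lin (G y, p y, m y)) (lin ('D_v G x, dp, dm)).
Proof.
move=> dG hp hm.
have cM (q : R * R -> R) (dq c : R) : is_derive x v q dq ->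
    is_derive x v (fun y => q y * c) (dq * c).
  move=> hq; apply: is_derive_eq (is_deriveM hq (is_derive_cst c x v)) _.
  by rewrite scaler0 add0r /GRing.scale /= mulrC.
have h1 : is_derive x v (fun y => \sum_i G y 0 i * lin (delta_mx 0 i, 0, 0))
    (\sum_i 'D_v G x 0 i * lin (delta_mx 0 i, 0, 0)).
  have -> : (fun y => \sum_i G y 0 i * lin (delta_mx 0 i, 0, 0)) =
      \sum_i (fun y => G y 0 i * lin (delta_mx 0 i, 0, 0)).
    by apply/funext => y; rewrite fct_sumE.
  by apply: is_derive_sum => i; exact/cM/is_derive_coord.
have -> : (fun y => lin (G y, p y, m y)) =
    (fun y => \sum_i G y 0 i * lin (delta_mx 0 i, 0, 0)) +
    (fun y => p y * lin (0, 1, 0)) + (fun y => m y * lin (0, 0, 1)).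
  by apply/funext => y; rewrite linE.
rewrite (linE ('D_v G x)).
exact: (is_deriveD (is_deriveD h1 (cM _ _ (lin (0, 1, 0)) hp))
  (cM _ _ (lin (0, 0, 1)) hm)).
Qed.

Lemma is_derive_cone G x v : derivable G x v ->
  is_derive x v (fun y => lin (cone (G y))) (lin (dcone (G x) ('D_v G x))).
Proof.
move=> dG; apply: is_derive_lin => //.
by apply: is_derive_eq (is_derive_dot dG dG) _; rewrite dotC; ring.
Qed.

(** [dcone] is linear in its second argument; its dependence on the base point sits in the middle
    component 2 (G, H), whence the extra multiple of (0, 1, 0). *)
Lemma is_derive_dcone G H x v : derivable G x v -> derivable H x v ->
  is_derive x v (fun y => lin (dcone (G y) (H y)))
    (lin (dcone (G x) ('D_v H x)) + 2 * dot ('D_v G x) (H x) * lin (0, 1, 0)).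
Proof.
move=> dG dH.
have h2 : is_derive x v (fun y => 2 * dot (G y) (H y))
    (2 * (dot ('D_v G x) (H x) + dot (G x) ('D_v H x))).
  apply: is_derive_eq (is_deriveM (is_derive_cst (2 : R) x v) (is_derive_dot dG
    dH)) _.
  by rewrite scaler0 addr0.
apply: is_derive_eq (is_derive_lin dH h2 (is_derive_cst 0 x v)) _.
by rewrite /dcone !(linE ('D_v H x)); ring.
Qed.

End ConeFunctions.

Lemma schwarz_rV (R : realType) n (D : set (R * R)) (F : R * R -> 'rV[R]_n) x :
  open D -> smooth 2 D F -> D x ->
  'D_(0, 1) ('D_(1, 0) F) x = 'D_(1, 0) ('D_(0, 1) F) x.
Proof.
move=> oD sF Dx; apply/rowP => j.
have [dF [dF1 _ _] [dF2 _ _]] := sF.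
have DD (u v : R * R) : differentiable ('D_u F) x ->
    ('D_v ('D_u F) x) 0 j = 'D_v ('D_u (fun y => F y 0 j)) x.
  move=> d; have dd : derivable ('D_u F) x v by exact: diff_derivable d.
  rewrite (derive_mx dd) mxE; apply: near_eq_derive.
  apply: filterS (open_nbhs_nbhs (conj oD Dx)) => y Dy.
  have ddy : derivable F y u by exact: diff_derivable (dF y Dy).
  by rewrite (derive_mx ddy) mxE.
have e := schwarz oD (smooth_coord j oD sF) Dx.
exact: etrans (DD (1, 0) (0, 1) (dF1 x Dx))
  (etrans e (esym (DD (0, 1) (1, 0) (dF2 x Dx)))).
Qed.

Lemma is_derive_minor (R : realType) (f1 f2 g1 g2 : R * R -> R)
    (a1 a2 b1 b2 : R) (x u : R * R) :
  is_derive x u f1 a1 -> is_derive x u f2 a2 ->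
  is_derive x u g1 b1 -> is_derive x u g2 b2 ->
  'D_u (fun y => f1 y * g2 y - g1 y * f2 y) x =
  a1 * g2 x + f1 x * b2 - (b1 * f2 x + g1 x * a2).
Proof.
move=> h1 h2 k1 k2.
have [_ ->] := is_deriveB (is_deriveM h1 k2) (is_deriveM k1 h2).
by rewrite /GRing.scale /=; ring.
Qed.

Section ConeQuotient.
Context (R : realType) (n : nat) (L : lorentz R n -> lorentz R n).
Hypothesis L_lin : linear L.
Implicit Types (G H : R * R -> 'rV[R]_n) (D : set (R * R)).

Let den u : R := (L u).2.
Let num (j : 'I_n) u : R := (L u).1.1 0 j.

Let den_lin k u v : den (k *: u + v) = k * den u + den v.
Proof. by rewrite /den L_lin. Qed.

Let num_lin j k u v : num j (k *: u + v) = k * num j u + num j v.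
Proof. by rewrite /num L_lin /= !mxE. Qed.

Lemma cpsi_coord v X j : cpsi L v X 0 j =
  den (cone v) * num j (dcone v X) - den (dcone v X) * num j (cone v).
Proof. by rewrite /cpsi !mxE. Qed.

Lemma smooth_cden k D G : open D -> smooth k D G ->
  smooth k D (fun x => cden L (G x)).
Proof. by move=> oD; exact: (smooth_cone den_lin). Qed.

Lemma smooth_cquot k D G : open D -> smooth k D G ->
  (forall x, D x -> cden L (G x) != 0) ->
  smooth k D (fun x => (cden L (G x))^-1 *: cnum L (G x)).
Proof.
move=> oD sG den0; apply: smooth_rV => // j.
have s1 := smoothV oD den0 (smooth_cden oD sG).
have s2 := smooth_cone (num_lin j) oD sG.
by apply: smooth_ext (smoothM oD s1 s2) => // x _; rewrite mxE.
Qed.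

Lemma smooth_cpsi k D G H : open D -> smooth k D G -> smooth k D H ->
  smooth k D (fun x => cpsi L (G x) (H x)).
Proof.
move=> oD sG sH; apply: smooth_rV => // j.
have s1 := smoothM oD (smooth_cone den_lin oD sG)
  (smooth_dcone (num_lin j) oD sG sH).
have s2 := smoothM oD (smooth_dcone den_lin oD sG sH)
  (smooth_cone (num_lin j) oD sG).
have s3 := smoothM oD (smooth_cst k D (-1 : R)) s2.
by apply: smooth_ext (smoothD oD s1 s3) => // x _; rewrite cpsi_coord mulN1r.
Qed.

(** The quotient rule for N / m, with [dcone] differentiating [cone]: N' / m - m' N / m^2 = m^-2 (m
    N' - m' N). *)
Lemma derive_cquot G x v : derivable G x v -> cden L (G x) != 0 ->
  derivable (fun y => (cden L (G y))^-1 *: cnum L (G y)) x v ->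
  'D_v (fun y => (cden L (G y))^-1 *: cnum L (G y)) x =
  cden L (G x) ^- 2 *: cpsi L (G x) ('D_v G x).
Proof.
move=> dG den0 dq; rewrite derive_mx //; apply/rowP => j;
  rewrite mxE [RHS]mxE cpsi_coord.
have d1 := is_derive_cone den_lin dG.
have d2 := is_derive_cone (num_lin j) dG.
have -> : (fun y => ((cden L (G y))^-1 *: cnum L (G y)) 0 j) =
    (fun y => (den (cone (G y)))^-1 * num j (cone (G y))).
  by apply/funext => y; rewrite mxE.
have dV : is_derive x v (fun y => (den (cone (G y)))^-1)
    (- (den (cone (G x))) ^- 2 *: den (dcone (G x) ('D_v G x))).
  have [dd <-] := d1; apply: DeriveDef; first exact: derivableV.
  exact: deriveV.
have [_ ->] := is_deriveM dV d2.
rewrite /cden /GRing.scale /=.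
rewrite -/(num j (cone (G x))) -/(den (cone (G x))).
rewrite -/(num j (dcone (G x) ('D_v G x))) -/(den (dcone (G x) ('D_v G x))).
by field.
Qed.

(* The differential of the form cpsi (G, dH) is a combination of terms
   symmetric in the two directions; those that are not cancel as
   d G /\ d H = 0. *)
Lemma cpsi_closed D F Fc x j : open D -> D x -> smooth 2 D F -> smooth 2 D Fc ->
  (exists a b : R, 'D_(1, 0) Fc x = a *: 'D_(1, 0) F x + b *: 'D_(0, 1) F x /\
    'D_(0, 1) Fc x = b *: 'D_(1, 0) F x - a *: 'D_(0, 1) F x) ->
  dot ('D_(1, 0) F x) ('D_(1, 0) F x) = dot ('D_(0, 1) F x) ('D_(0, 1) F x) ->
  dot ('D_(1, 0) F x) ('D_(0, 1) F x) = 0 ->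
  'D_(0, 1) (fun y => cpsi L (F y) ('D_(1, 0) Fc y) 0 j) x =
  'D_(1, 0) (fun y => cpsi L (F y) ('D_(0, 1) Fc y) 0 j) x.
Proof.
move=> oD Dx sF sFc [a [b [xc yc]]] xx xy.
have dpsi H u : derivable F x u -> derivable H x u ->
    'D_u (fun y => cpsi L (F y) (H y) 0 j) x =
      den (dcone (F x) ('D_u F x)) * num j (dcone (F x) (H x)) +
      den (cone (F x)) * (num j (dcone (F x) ('D_u H x)) +
        2 * dot ('D_u F x) (H x) * num j (0, 1, 0)) -
      ((den (dcone (F x) ('D_u H x)) +
        2 * dot ('D_u F x) (H x) * den (0, 1, 0)) * num j (cone (F x)) +
      den (dcone (F x) (H x)) * num j (dcone (F x) ('D_u F x))).
  move=> dF dH.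
  have d1 := is_derive_cone den_lin dF.
  have d2 := is_derive_cone (num_lin j) dF.
  have d3 := is_derive_dcone den_lin dF dH.
  have d4 := is_derive_dcone (num_lin j) dF dH.
  have -> : (fun y => cpsi L (F y) (H y) 0 j) =
      (fun y => den (cone (F y)) * num j (dcone (F y) (H y)) -
        den (dcone (F y) (H y)) * num j (cone (F y))).
    by apply/funext => y; rewrite cpsi_coord.
  exact: is_derive_minor d1 d2 d3 d4.
have [dF _ _] := sF; have [_ [dFc1 _ _] [dFc2 _ _]] := sFc.
have dFu u : derivable F x u by exact: diff_derivable (dF x Dx).
have dFc1u u : derivable ('D_(1, 0) Fc) x u.
  exact: diff_derivable (dFc1 x Dx).
have dFc2u u : derivable ('D_(0, 1) Fc) x u.
  exact: diff_derivable (dFc2 x Dx).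
apply: etrans (dpsi _ _ (dFu _) (dFc1u _)) _; apply: esym.
apply: etrans (dpsi _ _ (dFu _) (dFc2u _)) _; apply: esym.
(* With X, Y the partials of F, both inner products become b |Y|^2, and both minors become a (den Y
   num X - den X num Y), where X and Y stand for their images under [dcone]. *)
rewrite (schwarz_rV oD sFc Dx) xc yc.
move: ('D_(1, 0) ('D_(0, 1) Fc) x) => S.
move: ('D_(1, 0) F x) ('D_(0, 1) F x) xx xy => X Y xx xy.
have dconeE (lin : lorentz R n -> R) :
    (forall k u v, lin (k *: u + v) = k * lin u + lin v) ->
    forall c d, lin (dcone (F x) (c *: X + d *: Y)) =
    c * lin (dcone (F x) X) + d * lin (dcone (F x) Y).
  move=> ll c d; rewrite (linear_comb (@dcone_linear _ _ (F x))).
  exact: (@linear_comb R (lorentz R n) R^o lin ll).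
rewrite -scaleNr !(dconeE _ den_lin) !(dconeE _ (num_lin j)).
rewrite !dotE (dotC Y X) xx xy.
move: (den _) (den _) (den _) (den _) (num j _) (num j _) (num j _) (num j _).
move: (num j _).
by move: (dot Y Y) => *; ring.
Qed.

End ConeQuotient.

(** * Charts *)

Section Charts.
Context (R : realType) (M : riemannSurface R).
Implicit Types (i j : atlas M) (U : set M) (p q : M) (x y : R * R).

Definition plane_coord i p : R * R := ofC (chart M i p).

Definition chart_image i U : set (R * R) :=
  [set x | (chart M i @` (dom M i `&` U)) (toC x)].

Lemma chart_image_coord i U p : dom M i p -> U p -> chart_image i U
  (plane_coord i p).
Proof. by move=> ip Up; exists p => //; rewrite ofCK. Qed.

Lemma chart_imageP i U x : chart_image i U x ->
  let q := param M i (toC x) in [/\ dom M i q, U q & plane_coord i q = x].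
Proof.
by move=> [q [iq Uq] qx]; rewrite /= -qx chartK // /plane_coord qx toCK.
Qed.

Lemma open_chart_image i U : open U -> open (chart_image i U).
Proof.
move=> oU; rewrite openE => x ix.
have [iq Uq qx] := chart_imageP ix; set q := param M i (toC x) in iq Uq qx.
have xq : toC x = chart M i q by rewrite -qx ofCK.
apply: (@toC_continuous R x).
rewrite xq.
have nU : nbhs (param M i (chart M i q)) (dom M i `&` U).
  rewrite chartK //; apply: open_nbhs_nbhs; split=> //.
  exact: openI (dom_open i) oU.
have nparam := param_continuous iq nU.
(* [param] inverts the chart only on this image, so nearby points must lie in it before they can be
   written as [chart M i r]. *)
have nimg : nbhs (chart M i q) (chart M i @` dom M i).
  by apply: open_nbhs_nbhs; split; [exact: codom_open|exists q].
near=> z.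
have : (chart M i @` dom M i) z by near: z.
have : (dom M i `&` U) (param M i z) by near: z.
move=> + [r ir rz]; rewrite -rz chartK // => -[_ Ur]; exact: (ex_intro2 _ _ r).
Unshelve. all: by end_near. Qed.

Lemma coord_continuous_at i p : dom M i p -> {for p, continuous (plane_coord
  i)}.
Proof.
move=> ip; apply: (@continuous_comp _ _ _ (chart M i) (@ofC R)).
  exact: chart_continuous.
exact: ofC_continuous.
Qed.

Definition transition i j x : R * R := plane_coord j (param M i (toC x)).

Lemma transition_coord i j p : dom M i p -> transition i j (plane_coord i p) =
  plane_coord j p.
Proof. by move=> ip; rewrite /transition /plane_coord ofCK chartK. Qed.

Lemma differentiable_transition i j p : dom M i p -> dom M j p ->
  differentiable (transition i j) (plane_coord i p).
Proof.
move=> ip jp; apply: (@differentiable_holomorphic _ (chart M j \o param M i)).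
by rewrite ofCK; exact: transition_holomorphic.
Qed.

(** Chain rule: near the coordinate of p, the expression in chart i is the one in chart j composed
    with the transition map. *)
Lemma diff_local_expr n (h : M -> 'rV[R]_n) i j p : dom M i p -> dom M j p ->
  differentiable (local_expr h j) (plane_coord j p) ->
  differentiable (local_expr h i) (plane_coord i p) /\
  'd (local_expr h i) (plane_coord i p) =
    'd (local_expr h j) (plane_coord j p) \o 'd (transition i j) (plane_coord i
      p) :> (_ -> _).
Proof.
move=> ip jp dh; have dt := differentiable_transition ip jp.
rewrite -(transition_coord j ip) in dh *.
have e : \forall x \near plane_coord i p,
    (local_expr h j \o transition i j) x = local_expr h i x.
  have oij : open (chart_image i (dom M j)) := open_chart_image (dom_open j).
  apply: filterS (open_nbhs_nbhs (conj oij (chart_image_coord ip jp))) => x.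
  case/chart_imageP => _ jq _.
  by rewrite /local_expr /transition /= ofCK chartK.
have [d1 d2] := near_eq_differentiable e (differentiable_comp dt dh).
by split; [exact: d1|exact: etrans d2 (diff_comp dt dh)].
Qed.

End Charts.

Lemma differentiable_rV (R : realType) (V : normedModType R) n
    (F : V -> 'rV[R]_n) x :
  (forall j, differentiable (fun y => F y 0 j) x) -> differentiable F x.
Proof.
move=> dF; have -> : F = \sum_j (fun y => F y 0 j *: delta_mx 0 j).
  by apply/funext => y; rewrite fct_sumE -row_sum_delta.
by apply: differentiable_sum => j; exact/differentiableZl/dF.
Qed.

(** * The dual surface of the transformed immersion *)

Section LocalDual.
Context (R : realType) (n : nat) (M : riemannSurface R) (f fc : M -> 'rV[R]_n).
Context (L : lorentz R n -> lorentz R n).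
Hypothesis L_lin : linear L.
Hypotheses (f_smooth : smooth_on setT f) (fc_smooth : smooth_on setT fc).
Hypothesis f_conformal : conformal_immersion_on setT f.
Hypothesis f_fc : forall i q, dom M i q ->
  forall X Y, wedge (differential f i q) (differential fc i q) X Y = 0.

Lemma local_expr_coord (h : M -> 'rV[R]_n) i q : dom M i q ->
  local_expr h i (plane_coord i q) = h q.
Proof. by move=> iq; rewrite /local_expr /plane_coord ofCK chartK. Qed.

Lemma smooth_local_expr (h : M -> 'rV[R]_n) i k : smooth_on setT h ->
  smooth k (chart_image i setT) (local_expr h i).
Proof. by move=> sh; apply/class_C_smooth; exact: sh. Qed.

Lemma local_dual (i : atlas M) p : dom M i p -> cden L (f p) != 0 ->
  exists (U : set M) (gc : M -> 'rV[R]_n), [/\ open U, U p,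
    forall q, U q -> dom M i q /\ cden L (f q) != 0 &
    forall q, U q -> differentiable (local_expr gc i) (plane_coord i q) /\
      forall X, 'd (local_expr gc i) (plane_coord i q) X =
        cpsi L (f q) ('d (local_expr fc i) (plane_coord i q) X)].
Proof.
move=> ip fp0; set F := local_expr f i; set Fc := local_expr fc i.
pose W := chart_image i [set: M].
have oW : open W by exact: open_chart_image openT.
have sF k : smooth k W F by exact: smooth_local_expr.
have sFc k : smooth k W Fc by exact: smooth_local_expr.
have Wp : W (plane_coord i p) by exact: chart_image_coord.
(* Choosing the rectangle inside D keeps T o f finite on it, so that g and its dual live on the same
   U. *)
pose D := [set x | W x /\ cden L (F x) != 0].
have oD : open D.
  rewrite openE => x [Wx Dx].
  have nW := open_nbhs_nbhs (conj oW Wx).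
  have /(cvgr_neq0 _)/(_ Dx) nD := smooth_cden L_lin oW (sF 0%N) x Wx.
  by near=> y; split; near: y.
have Dp : D (plane_coord i p) by split=> //; rewrite /F local_expr_coord.
have [e e0 eD] := closed_rectangle_nbhs oD Dp.
set Q := `](plane_coord i p).1 - e, (plane_coord i p).1 + e[ `*`
         `](plane_coord i p).2 - e, (plane_coord i p).2 + e[.
have QD : Q `<=` D.
  by move=> x [x1 x2]; apply: eD; split; exact: subset_itv_oo_cc.
have [_ sFc1 sFc2] := sFc 2%N; have DW : D `<=` W by move=> x [].
pose al j x := cpsi L (F x) ('D_(1, 0) Fc x) 0 j.
pose be j x := cpsi L (F x) ('D_(0, 1) Fc x) 0 j.
have sal j : smooth 1 D (al j).
  exact: smooth_sub DW (smooth_coord j oW (smooth_cpsi L_lin oW (sF 1%N) sFc1)).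
have sbe j : smooth 1 D (be j).
  exact: smooth_sub DW (smooth_coord j oW (smooth_cpsi L_lin oW (sF 1%N) sFc2)).
(* At the point with coordinate x, conformality and the wedge condition provide, through
   [clifford_christoffel], the coefficients a, b required by [cpsi_closed]. *)
have clo j x : D x -> 'D_(0, 1) (al j) x = 'D_(1, 0) (be j) x.
  move=> [Wx _]; have [iq _ qx] := chart_imageP Wx.
  set q := param M i (toC x) in iq qx.
  have [_ [l l0 fl]] := f_conformal iq I; have fw := f_fc iq.
  have dF : differentiable F x by have [h _ _] := sF 1%N; exact: h.
  have dFc : differentiable Fc x by have [h _ _] := sFc 1%N; exact: h.
  have FD v : 'D_v F x = differential f i q v.
    by rewrite (deriveE v dF) /differential -/(plane_coord i q) qx.
  have FcD v : 'D_v Fc x = differential fc i q v.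
    by rewrite (deriveE v dFc) /differential -/(plane_coord i q) qx.
  apply: (cpsi_closed L_lin j oW Wx (sF 2%N) (sFc 2%N)); rewrite !FD.
  - rewrite !FcD; apply: (@clifford_christoffel _ _ l) => //.
    + by rewrite fl /=; ring.
    + by rewrite fl /=; ring.
    + by rewrite fl /=; ring.
    + by apply/eqP; rewrite -subr_eq0; apply/eqP; exact: fw.
  - by rewrite !fl /=; ring.
  - by rewrite !fl /=; ring.
(* [poincare] concerns scalar forms, so a primitive is chosen for each component; U consists of the
   points with coordinates in the open rectangle Q. *)
have /choice[h hP] := fun j => poincare eD (sal j) (sbe j) (clo j).
exists (dom M i `&` (plane_coord i @^-1` Q)).
exists (fun q => \row_j h j (plane_coord i q)); split.
- rewrite openE => q [iq Qq]; apply: filterI.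
    exact: open_nbhs_nbhs (conj (dom_open i) iq).
  apply: (coord_continuous_at iq); apply: open_nbhs_nbhs; split=> //.
  by apply: open_setX; exact: itv_open.
- by split=> //; split; rewrite /= in_itv /=; apply/andP; split; lra.
- by move=> q [iq /QD[_]]; rewrite /F local_expr_coord.
- move=> q [iq Qq]; have [Wq _] := QD _ Qq.
  set x := plane_coord i q in Qq Wq *.
  pose H y : 'rV[R]_n := \row_j h j y.
  have oQ : open Q by apply: open_setX; exact: itv_open.
  have dH : differentiable H x.
    apply: differentiable_rV => j; have [d _ _] := hP j _ Qq.
    by congr (differentiable _ x): d; apply/funext => y; rewrite mxE.
  have HD (v : R * R) : 'D_v H x = \row_j 'D_v (h j) x.
    rewrite derive_mx; last exact: diff_derivable dH.
    apply/rowP => j; rewrite !mxE; congr ('D_v _ x).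
    by apply/funext => y; rewrite mxE.
  have e1 : \forall y \near x, H y = local_expr (fun q => \row_j h j
    (plane_coord i q)) i y.
    apply: filterS (open_nbhs_nbhs (conj oQ Qq)) => y /QD[Wy _].
    by have [_ _ yE] := chart_imageP Wy; rewrite /local_expr yE.
  have [d1 d2] := near_eq_differentiable e1 dH; split; first exact: d1.
  have dFc : differentiable Fc x by have [d _ _] := sFc 1%N; exact: d.
  have dE (G : R * R -> 'rV[R]_n) X : differentiable G x ->
      'd G x X = X.1 *: 'D_(1, 0) G x + X.2 *: 'D_(0, 1) G x.
    move=> dG; have e10 := deriveE ((1, 0) : R * R) dG.
    have e01 := deriveE ((0, 1) : R * R) dG; rewrite e10 e01.
    exact: (linear_planeE (linearP ('d G x))).
  have H1 : 'D_(1, 0) H x = cpsi L (F x) ('D_(1, 0) Fc x).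
    by apply/rowP => j; have [_ a1 _] := hP j _ Qq; rewrite HD mxE a1.
  have H2 : 'D_(0, 1) H x = cpsi L (F x) ('D_(0, 1) Fc x).
    by apply/rowP => j; have [_ _ a2] := hP j _ Qq; rewrite HD mxE a2.
  have fq : f q = F x by rewrite /F /x local_expr_coord.
  move=> X; apply: etrans (congr1 (fun G => G X) d2) _.
  apply: etrans (dE H X dH) _; rewrite H1 H2 fq.
  rewrite -(linear_comb (cpsi_linear L_lin (F x))).
  by congr cpsi; apply: esym; exact: dE Fc X dFc.
Unshelve. all: by end_near. Qed.

(** * From the chart of construction to all charts *)

Section Transfer.
Variables (U : set M) (gc : M -> 'rV[R]_n) (i0 : atlas M).
Hypothesis U_open : open U.
Hypothesis U_i0 : forall q, U q -> dom M i0 q /\ cden L (f q) != 0.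
Hypothesis d_gc : forall q, U q ->
  differentiable (local_expr gc i0) (plane_coord i0 q) /\
  forall X, 'd (local_expr gc i0) (plane_coord i0 q) X =
    cpsi L (f q) ('d (local_expr fc i0) (plane_coord i0 q) X).

(** A change of chart precomposes both differentials with that of the same transition map, while
    [cpsi L (f q)] acts on values; hence the relation does not depend on the chart. *)
Lemma diff_dual i q : dom M i q -> U q ->
  differentiable (local_expr gc i) (plane_coord i q) /\
  forall X, 'd (local_expr gc i) (plane_coord i q) X =
    cpsi L (f q) ('d (local_expr fc i) (plane_coord i q) X).
Proof.
move=> iq Uq; have [i0q _] := U_i0 Uq; have [dg0 dgE] := d_gc Uq.
have [dg gE] := diff_local_expr iq i0q dg0.
have [dfc0 _ _] := smooth_local_expr i0 1%N fc_smooth.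
have [_ cE] := diff_local_expr iq i0q (dfc0 _ (chart_image_coord i0q I)).
split=> [|X]; first exact: dg.
have hg := congr1 (fun G => G X) gE; have hc := congr1 (fun G => G X) cE.
exact: etrans hg (etrans (dgE _) (esym (congr1 (cpsi L (f q)) hc))).
Qed.

Lemma smooth_dual : smooth_on U gc.
Proof.
(* Class C^(k+1) is proved instead of C^k: this needs differentiability and C^k partial derivatives,
   both read off from [diff_dual], with no induction on k. *)
move=> i k; apply/class_C_smooth; apply: smoothW.
have oE : open (chart_image i U) := open_chart_image U_open.
have ET : chart_image i U `<=` chart_image i setT.
  by move=> x [q [iq _] qx]; exists q.
have sF := smooth_sub ET (smooth_local_expr i k f_smooth).
have [dFc sFc1 sFc2] := smooth_local_expr i k.+1 fc_smooth.
have dE (v : R * R) : {in chart_image i U, forall x,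
    cpsi L (local_expr f i x) ('D_v (local_expr fc i) x) =
    'D_v (local_expr gc i) x}.
  move=> x /set_mem Ex; have [iq Uq qx] := chart_imageP Ex.
  have [d dg] := diff_dual iq Uq; rewrite qx in d dg.
  have e1 := deriveE v d; have e2 := deriveE v (dFc x (ET x Ex)).
  exact: etrans (congr1 (cpsi L _) e2) (etrans (esym (dg v)) (esym e1)).
split.
- move=> x Ex; have [iq Uq qx] := chart_imageP Ex.
  by have [d _] := diff_dual iq Uq; rewrite qx in d.
- have s := smooth_cpsi L_lin oE sF (smooth_sub ET sFc1).
  exact: smooth_ext oE (dE (1, 0)) s.
- have s := smooth_cpsi L_lin oE sF (smooth_sub ET sFc2).
  exact: smooth_ext oE (dE (0, 1)) s.
Qed.

Let g q := (cden L (f q))^-1 *: cnum L (f q).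

Lemma smooth_quotient : smooth_on U g.
Proof.
move=> i k; apply/class_C_smooth.
have oE : open (chart_image i U) := open_chart_image U_open.
have ET : chart_image i U `<=` chart_image i setT.
  by move=> x [q [iq _] qx]; exists q.
apply: (smooth_cquot L_lin oE (smooth_sub ET (smooth_local_expr i k f_smooth))).
by move=> x /chart_imageP[_ /U_i0[_]].
Qed.

Lemma diff_quotient i q : dom M i q -> U q -> forall X,
  'd (local_expr g i) (plane_coord i q) X =
  cden L (f q) ^- 2 *: cpsi L (f q) ('d (local_expr f i) (plane_coord i q) X).
Proof.
move=> iq Uq X; have [_ den0] := U_i0 Uq.
have /class_C_smooth[dg _ _] := smooth_quotient i 1%N.
have {}dg := dg _ (chart_image_coord iq Uq).
have [df _ _] := smooth_local_expr i 1%N f_smooth.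
have {}df := df _ (chart_image_coord iq I).
have fq := local_expr_coord f iq.
have e1 := deriveE X dg; have e2 := deriveE X df.
have Fq0 : cden L (local_expr f i (plane_coord i q)) != 0 by rewrite fq.
have df' : derivable (local_expr f i) (plane_coord i q) X by exact:
  diff_derivable df.
have dg' : derivable (local_expr g i) (plane_coord i q) X by exact:
  diff_derivable dg.
have d := derive_cquot L_lin df' Fq0 dg'.
apply: etrans (esym e1) (etrans d _); rewrite fq.
by congr (_ *: cpsi _ _ _); exact: e2.
Qed.

End Transfer.

End LocalDual.

Theorem proposition2p6 (R : realType) (n : nat) (M : polarisedSurface R)
    (f : M -> 'rV[R]_n) (T : sphere R n -> sphere R n)
    (f_isothermic : isothermic f) (T_moebius : moebius T) (p : M)
    (Tfp_finite : T (Some (f p)) <> None) :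
  exists (U : set M) (g : M -> 'rV[R]_n),
    [/\ open U, U p, (forall q, U q -> T (Some (f q)) = Some (g q))
      & isothermic_on U g].
Proof.
have [L [L_lin L_iso LT]] := moebius_isometry T_moebius.
have [sf cf [fc [sfc fcP]]] := f_isothermic.
(* The denominator vanishes exactly when T sends f p to infinity. *)
have den0 : cden L (f p) != 0.
  apply/eqP => d0; apply: Tfp_finite.
  by rewrite LT /cone_point -/(cden L (f p)) d0 eqxx.
have [i ip] := dom_cover p.
have f_fc j q : dom M j q ->
    forall X Y, wedge (differential f j q) (differential fc j q) X Y = 0.
  by move=> jq; exact: (fcP j q jq I).1.
have [U [gc [oU Up Ui dgc]]] := local_dual L_lin sf sfc cf f_fc ip den0.
exists U, (fun q => (cden L (f q))^-1 *: cnum L (f q)); split=> //.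
  move=> q /Ui[_ d0].
  by rewrite LT /cone_point -/(cden L (f q)) (negPf d0).
pose g q := (cden L (f q))^-1 *: cnum L (f q).
(* [isothermic_pointwise] with P = [cpsi L (f q)] and m = [cden L (f q)], in an arbitrary chart
   j. *)
have pw j q : dom M j q -> U q ->
  [/\ injective (differential g j q),
      exists2 l : R, 0 < l & forall X Y : R * R,
        dot (differential g j q X) (differential g j q Y) =
        l * (X.1 * Y.1 + X.2 * Y.2),
      forall X Y, wedge (differential g j q) (differential gc j q) X Y = 0 &
      part20 (differential g j q) (differential gc j q) =
        part20 (differential f j q) (differential fc j q)].
  move=> jq Uq; have [_ [l l0 fl]] := cf j q jq I.
  have dg := diff_quotient L_lin sf oU Ui jq Uq.
  have [_ dc] := diff_dual sfc Ui dgc jq Uq.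
  exact: isothermic_pointwise (linearP _) (linearP _)
    (cpsi_linear L_lin (f q)) l0 (Ui q Uq).2 fl (cpsi_dot L_iso (f q)) dg dc
    (f_fc j q jq).
split.
- exact (smooth_quotient L_lin sf oU Ui).
- by move=> j q jq Uq; have [inj conf _ _] := pw j q jq Uq.
- exists gc; split; first exact (smooth_dual L_lin sf sfc oU Ui dgc).
  move=> j q jq Uq; have [_ _ w ->] := pw j q jq Uq; split=> //.
  exact: (fcP j q jq I).2.
Qed.
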